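(* Let $\mu>0$ and let $x^*$ be the optimal solution of $\min_{x\in X}\{\Psi(x)=\sum_{i=1}^m f_i(x)+h(x)+\mu\,\omega(x)\}$. Suppose the parameters of the randomized primal-dual gradient (RPDG) method are constant, $\tau_t=\tau$, $\eta_t=\eta$, $\alpha_t=\alpha$ for all $t\ge1$, and satisfy, for some $\alpha\in(0,1)$, $$(1-\alpha)(1+\tau)\le p_i,\quad i=1,\dots,m,$$ $$\eta\le\alpha(\mu+\eta),$$ $$\eta\,\tau\,p_i\ge 4L_i,\quad i=1,\dots,m.$$ Then for any $k\ge1$, $$\mathbb{E}[P(x^k,x^* )]\le\Big(1+\frac{L_f\alpha}{(1-\alpha)\eta}\Big)\alpha^kP(x^0,x^* ),$$ $$\mathbb{E}[\Psi(\bar x^k)-\Psi(x^* )]\le\alpha^{k/2}\Big(\alpha^{-1}\eta+\frac{3-2\alpha}{1-\alpha}L_f+\frac{2L_f^2\alpha}{(1-\alpha)\eta}\Big)P(x^0,x^* ),$$ where $\bar x^k=(\sum_{t=1}^k\theta_t)^{-1}\sum_{t=1}^k\theta_tx^t$ with $\theta_t=\alpha^{-t}$, and the expectation is taken with respect to $i_1,\dots,i_k$.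
   Context: Problem data: $X\subseteq\mathbb{R}^n$ is closed convex; $\|\cdot\|$ is an arbitrary norm on $\mathbb{R}^n$ with conjugate norm $\|\cdot\|_*$; $f_i:\mathbb{R}^n\to\mathbb{R}$ ($i=1,\dots,m$) are convex, differentiable, with $\|\nabla f_i(x_1)-\nabla f_i(x_2)\|_*\le L_i\|x_1-x_2\|$ for all $x_1,x_2$; $f=\sum_if_i$, $L=\sum_iL_i$; $L_f\ge0$ is a constant with $\|\nabla f(x_1)-\nabla f(x_2)\|_*\le L_f\|x_1-x_2\|\le L\|x_1-x_2\|$ for all $x_1,x_2$; $h:X\to\mathbb{R}$ is convex; $\omega:X\to\mathbb{R}$ is strongly convex with modulus $1$ w.r.t. $\|\cdot\|$. Primal prox-function: $P(x^0,x)=\omega(x)-[\omega(x^0)+\langle\omega'(x^0),x-x^0\rangle]$, $\omega'(x^0)\in\partial\omega(x^0)$, so $P(x^0,x)\ge\frac12\|x-x^0\|^2$. Prox-mapping: $\mathcal{M}_X(g,x^0,\eta)=\arg\min_{x\in X}\{\langle g,x\rangle+h(x)+\mu\,\omega(x)+\eta P(x^0,x)\}$ (assumed computable, in particular well defined). The subgradients of $\omega$ are selected recursively: if $x^1=\mathcal{M}_X(g,x^0,\eta)$, then $\omega'(x^1)\in\partial\omega(x^1)$ is chosen so that for some $h'(x^1)\in\partial h(x^1)$, $\langle g+h'(x^1)+(\mu+\eta)\omega'(x^1)-\eta\omega'(x^0),x-x^1\rangle\ge0$ for all $x\in X$; this $\omega'(x^1)$ is used in $P(x^1,\cdot)$.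 RPDG method: given $x^0=x^{-1}\in X$, nonnegative parameters $\{\tau_t\},\{\eta_t\},\{\alpha_t\}$ and probabilities $p_1,\dots,p_m$ summing to $1$, set $\underline x_i^0=x^0$, $y_i^0=\nabla f_i(x^0)$ for all $i$. For $t=1,\dots,k$: draw $i_t$ independently with $\mathrm{Prob}\{i_t=i\}=p_i$; set $\tilde x^t=\alpha_t(x^{t-1}-x^{t-2})+x^{t-1}$; for $i=i_t$ set $\underline x_i^t=(\tilde x^t+\tau_t\underline x_i^{t-1})/(1+\tau_t)$, $y_i^t=\nabla f_i(\underline x_i^t)$, $\tilde y_i^t=p_i^{-1}(y_i^t-y_i^{t-1})+y_i^{t-1}$; for $i\ne i_t$ set $\underline x_i^t=\underline x_i^{t-1}$, $y_i^t=\tilde y_i^t=y_i^{t-1}$; finally $x^t=\mathcal{M}_X(\sum_{i=1}^m\tilde y_i^t,x^{t-1},\eta_t)$. *)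

(* Defs.v *)
From HB Require Import structures.
From mathcomp Require Import all_boot all_order all_algebra finmap.
From mathcomp Require Import all_classical all_reals all_analysis.
Import Order.TTheory GRing.Theory Num.Theory numFieldNormedType.Exports.

Set Implicit Arguments.
Unset Strict Implicit.
Unset Printing Implicit Defensive.

Local Open Scope classical_set_scope.
Local Open Scope ring_scope.

Section euclidean_space.
Context {R : realType} {n : nat}.
Local Notation V := 'rV[R]_n.

Definition dotv (g x : V) : R := \sum_(j < n) g 0 j * x 0 j.

(* The norm is a plain function, independent of the sup norm that the library
   puts on 'rV[R]_n and that only serves as its topology below. *)
Record is_norm (N : V -> R) : Prop := IsNorm {
  norm_triangle : forall x y, N (x + y) <= N x + N y ;
  norm_homogeneous : forall a x, N (a *: x) = `|a| * N x ;
  norm_definite : forall x, N x = 0 -> x = 0 }.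

Definition conjugate_norm (N : V -> R) (g : V) : R :=
  sup [set dotv g x | x in [set x : V | N x <= 1]].

Definition grad (f : V -> R) (x : V) : V :=
  \row_(j < n) 'D_(delta_mx 0 j) (f : V -> R^o) x.

(* Functions on X are represented by total functions whose values outside X
   are never used. *)

Definition strongly_convex (N : V -> R) (X : set V) (sigma : R)
    (w : V -> R) : Prop :=
  forall (t : R) (x y : V), 0 <= t <= 1 -> X x -> X y ->
    w (t *: x + (1 - t) *: y) <=
      t * w x + (1 - t) * w y - sigma / 2 * t * (1 - t) * N (x - y) ^+ 2.

Definition is_subgradient (X : set V) (w : V -> R) (x g : V) : Prop :=
  forall z, X z -> w x + dotv g (z - x) <= w z.

Definition is_minimizer (X : set V) (F : V -> R) (x : V) : Prop :=
  X x /\ forall z, X z -> F x <= F z.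

(* dw0 is the subgradient of w selected at x0 *)
Definition prox_fun (w : V -> R) (x0 dw0 x : V) : R :=
  w x - (w x0 + dotv dw0 (x - x0)).

(* x1 is the image of (g, x0, eta) under the prox-mapping, and dw1 an
   admissible selection of the subgradient of w at x1. *)
Definition prox_step (X : set V) (h w : V -> R) (mu : R)
    (g x0 dw0 : V) (eta : R) (x1 dw1 : V) : Prop :=
  [/\ is_minimizer X
        (fun x => dotv g x + h x + mu * w x + eta * prox_fun w x0 dw0 x) x1,
      is_subgradient X w x1 dw1
    & exists2 dh1, is_subgradient X h x1 dh1 &
        forall x, X x ->
          0 <= dotv (g + dh1 + (mu + eta) *: dw1 - eta *: dw0) (x - x1) ].

End euclidean_space.

Section rpdg.
Context {R : realType} {n m : nat}.
Local Notation V := 'rV[R]_n.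

(* Since 0.-1 = 0, the truncated index t.-1 encodes x^{-1} = x^0. *)
Definition extrapolation (alpha : nat -> R) (x : nat -> V) (t : nat) : V :=
  alpha t.+1 *: (x t - x t.-1) + x t.

(* One sample path of k iterations; i_ t, tau t, eta t, alpha t for
   1 <= t <= k are the draw and the parameters of the t-th iteration, and dw t
   is the subgradient of w selected at x t. *)
Record rpdg_run (X : set V) (f_ : 'I_m -> V -> R) (h w : V -> R) (mu : R)
    (p : 'I_m -> R) (tau eta alpha : nat -> R) (k : nat) (x0 dw0 : V)
    (i_ : nat -> 'I_m) (x dw : nat -> V) (xu y yt : nat -> 'I_m -> V)
    : Prop := RpdgRun {
  run_x0 : x 0 = x0 ;
  run_dw0 : dw 0 = dw0 ;
  run_xu0 : forall i, xu 0 i = x0 ;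
  run_y0 : forall i, y 0 i = grad (f_ i) x0 ;
  run_drawn : forall t i, (t < k)%N -> i = i_ t.+1 ->
    [/\ xu t.+1 i = (1 + tau t.+1)^-1 *:
                      (extrapolation alpha x t + tau t.+1 *: xu t i),
        y t.+1 i = grad (f_ i) (xu t.+1 i)
      & yt t.+1 i = (p i)^-1 *: (y t.+1 i - y t i) + y t i ] ;
  run_not_drawn : forall t i, (t < k)%N -> i <> i_ t.+1 ->
    [/\ xu t.+1 i = xu t i, y t.+1 i = y t i & yt t.+1 i = y t i ] ;
  run_prox : forall t, (t < k)%N ->
    prox_step X h w mu (\sum_(i < m) yt t.+1 i) (x t) (dw t) (eta t.+1)
      (x t.+1) (dw t.+1) }.

Definition ergodic_mean (theta : nat -> R) (x : nat -> V) (k : nat) : V :=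
  (\sum_(1 <= t < k.+1) theta t)^-1 *: \sum_(1 <= t < k.+1) theta t *: x t.

End rpdg.

Section draws.
Context {R : realType} {d : measure_display} {T : measurableType d}.
Variable Pr : probability T R.

Definition mutually_independent {S : Type} (D : set nat)
    (i_ : nat -> T -> S) : Prop :=
  forall (J : {fset nat}) (A : nat -> set S), [set` J] `<=` D ->
    Pr (\bigcap_(t in [set` J]) (i_ t @^-1` A t)) =
    (\prod_(t <- J) Pr (i_ t @^-1` A t))%E.

Definition independent_draws {m : nat} (p : 'I_m -> R) (k : nat)
    (i_ : nat -> T -> 'I_m) : Prop :=
  [/\ forall t i, (1 <= t <= k)%N -> measurable (i_ t @^-1` [set i]),
      forall t i, (1 <= t <= k)%N -> Pr (i_ t @^-1` [set i]) = (p i)%:E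
    & mutually_independent [set t | (1 <= t <= k)%N] i_ ].

(* Z t is a function of the draws i_ 1, ..., i_ t only. *)
Definition nonanticipating {S U : Type} (k : nat)
    (i_ : nat -> T -> S) (Z : nat -> T -> U) : Prop :=
  forall t o1 o2, (t <= k)%N ->
    (forall s, (1 <= s <= t)%N -> i_ s o1 = i_ s o2) -> Z t o1 = Z t o2.

End draws.

(* Main.v *)
(* The dual points y_i are gradients, so the dual prox-function of the conjugate
   of f_i is the Bregman distance of f_i and conjugates can be avoided.  The
   potential
     Phi_t = sum_(r <= t) alpha^-r G(x^r)
             + alpha^-t [(mu + eta) P(x^t, x^* )
                         + sum_i (1 + tau) / p_i D_i(y_i^t, y_i^* )
                         + <sum_i (y_i^t - y_i^* ), x^t - x^{t-1}>
                         + eta / 4 |x^t - x^{t-1}|^2],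
   where G >= 0 is the gap Psi - Psi(x^* ) with f linearized at x^*, is a
   supermartingale: the expectation over i_t of the dual three-point identity
   contracts the D_i by alpha, and the correlation between x^t and the sampled
   gradient is absorbed by cocoercivity, using 4 L_i <= eta tau p_i.  The same
   condition makes the bracket at least (mu + eta) P(x^t, x^* ), which gives the
   first bound.  The second one follows from
   Psi - Psi(x^* ) <= G + L_f / 2 |. - x^*|^2, Jensen's inequality and
   k <= alpha^(k/2) sum_(1 <= t <= k) alpha^-t.

   All p_i are positive, so every history of draws is realized by some outcome,
   and expectations are finite sums over histories. *)

Require Import Defs.
From HB Require Import structures.
From mathcomp Require Import all_boot all_order all_algebra finmap.
From mathcomp Require Import all_classical all_reals all_analysis.
From mathcomp Require Import ring lra.
Import Order.TTheory GRing.Theory Num.Theory numFieldNormedType.Exports.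

Local Open Scope classical_set_scope.
Local Open Scope ring_scope.

Set Implicit Arguments.
Unset Strict Implicit.
Unset Printing Implicit Defensive.

(** * Norms and smooth convex functions *)

(** Stands in for letting s tend to 0 in the arguments along segments and subdivisions. *)
Lemma le_of_le_add_small (R : realFieldType) (a b c : R) :
  (forall s, 0 < s < 1 -> a <= b + s * c) -> a <= b.
Proof.
move=> H; rewrite leNgt; apply/negP => ba.
have d_gt0 : 0 < `|c| + (a - b) + 1 by have := normr_ge0 c; lra.
(* The witness is below 1 and makes s * c smaller than a - b. *)
have Hs : 0 < (a - b) / 2 / (`|c| + (a - b) + 1) < 1.
  by rewrite divr_gt0 ?ltr_pdivrMr //=; have := normr_ge0 c; lra.
have := H _ Hs; rewrite leNgt => /negP; apply.
rewrite -ltrBrDl mulrAC ltr_pdivrMr//.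
have : (a - b) / 2 * c <= (a - b) / 2 * `|c|.
  by rewrite ler_wpM2l ?ler_norm//; lra.
have := mulr_ge0 (ltW (_ : 0 < a - b)) (normr_ge0 c).
rewrite subr_gt0 => /(_ ba).
have : 0 < (a - b) * (a - b) by rewrite mulr_gt0 ?subr_gt0.
lra.
Qed.

Section dotv.
Context {R : realType} {n : nat}.
Implicit Types (g u v : 'rV[R]_n) (a : R).

Lemma dotvDl g u v : dotv (g + u) v = dotv g v + dotv u v.
Proof. by rewrite /dotv -big_split; apply: eq_bigr => j _; rewrite mxE mulrDl. Qed.

Lemma dotvDr g u v : dotv g (u + v) = dotv g u + dotv g v.
Proof. by rewrite /dotv -big_split; apply: eq_bigr => j _; rewrite mxE mulrDr. Qed.

Lemma dotvZl a g v : dotv (a *: g) v = a * dotv g v.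
Proof. by rewrite /dotv mulr_sumr; apply: eq_bigr => j _; rewrite mxE mulrA. Qed.

Lemma dotvZr a g v : dotv g (a *: v) = a * dotv g v.
Proof. by rewrite /dotv mulr_sumr; apply: eq_bigr => j _; rewrite mxE mulrCA. Qed.

Lemma dotvNl g v : dotv (- g) v = - dotv g v.
Proof. by rewrite -scaleN1r dotvZl mulN1r. Qed.

Lemma dotvNr g v : dotv g (- v) = - dotv g v.
Proof. by rewrite -scaleN1r dotvZr mulN1r. Qed.

Lemma dotvBl g u v : dotv (g - u) v = dotv g v - dotv u v.
Proof. by rewrite dotvDl dotvNl. Qed.

Lemma dotv0r g : dotv g 0 = 0.
Proof. by rewrite -(scale0r 0) dotvZr mul0r. Qed.

Lemma dotv_suml (I : finType) (F : I -> 'rV[R]_n) v :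
  dotv (\sum_i F i) v = \sum_i dotv (F i) v.
Proof.
rewrite /dotv exchange_big; apply: eq_bigr => j _.
by rewrite summxE mulr_suml.
Qed.

Definition dotvE := (dotvDl, dotvDr, dotvNl, dotvNr, dotvZl, dotvZr).

End dotv.

(** * Equivalence of norms and the pairing inequality for the conjugate norm *)

Section norm.
Context {R : realType} {n : nat} {N : 'rV[R]_n -> R} (N_norm : is_norm N).

Lemma norm_zero : N 0 = 0.
Proof. by rewrite -(scale0r 0) (norm_homogeneous N_norm) normr0 mul0r. Qed.

Lemma norm_opp v : N (- v) = N v.
Proof. by rewrite -scaleN1r (norm_homogeneous N_norm) normrN normr1 mul1r. Qed.

Lemma norm_sqrZ a v : N (a *: v) ^+ 2 = a ^+ 2 * N v ^+ 2.
Proof. by rewrite (norm_homogeneous N_norm) exprMn real_normK ?num_real. Qed.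

Lemma norm_ge0 v : 0 <= N v.
Proof.
have := norm_triangle N_norm v (- v).
by rewrite subrr norm_zero norm_opp; lra.
Qed.

Lemma norm_sum (I : finType) (F : I -> 'rV[R]_n) :
  N (\sum_i F i) <= \sum_i N (F i).
Proof.
apply: (big_ind2 (fun a b => N a <= b)) => [|a1 b1 a2 b2 h1 h2|//].
  by rewrite norm_zero.
by apply: le_trans (norm_triangle N_norm _ _) _; exact: lerD.
Qed.

Lemma ler_coord_norm (v : 'rV[R]_n) j : `|v 0 j| <= `|v|.
Proof.
by rewrite [leRHS]/Num.norm /= mx_normrE; apply/bigmax_geP; right => /=; exists (0, j).
Qed.

Lemma row_sum_delta (v : 'rV[R]_n) : v = \sum_j v 0 j *: delta_mx 0 j.
Proof. by rewrite [LHS]matrix_sum_delta big_ord1. Qed.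

Lemma norm_le_sup v : N v <= `|v| * \sum_j N (delta_mx 0 j).
Proof.
rewrite {1}(row_sum_delta v) mulr_sumr; apply: le_trans (norm_sum _) _.
apply: ler_sum => j _; rewrite (norm_homogeneous N_norm) ler_wpM2r ?norm_ge0//.
exact: ler_coord_norm.
Qed.

Lemma is_norm_continuous : continuous N.
Proof.
set C := \sum_j N (delta_mx 0 j).
have C_ge0 : 0 <= C by apply: sumr_ge0 => j _; exact: norm_ge0.
move=> v; apply/(@cvgrPdist_lt R R^o _ (nbhs v) (nbhs_filter v)) => e e0.
have dist_le a b : N a - N b <= `|a - b| * C.
  rewrite lerBlDr; apply: le_trans _ (lerD (norm_le_sup _) (lexx _)).
  by rewrite -{1}(subrK b a) (norm_triangle N_norm).
have : nbhs v (ball v (e / (C + 1))).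
  by apply: nbhsx_ballx; rewrite divr_gt0 ?ltr_wpDl.
apply: filterS => u; rewrite -ball_normE /= ltr_pdivlMr ?ltr_wpDl// => vu.
apply: (@le_lt_trans _ _ (`|v - u| * C)).
  by rewrite ler_norml lerNl opprB dist_le andbT (distrC v u) dist_le.
by apply: le_lt_trans vu; rewrite ler_wpM2l ?lerDl.
Qed.

(** [N] is continuous, so it attains its minimum on the compact unit sphere of the sup norm, and
    definiteness makes this minimum positive. *)
Lemma sup_le_norm : exists2 c : R, 0 < c & forall v, c * `|v| <= N v.
Proof.
(* In dimension 0 the sphere is empty and any positive constant works. *)
have [[u u0]|no] := pselect (exists u : 'rV[R]_n, u != 0); last first.
  exists 1 => // v; have [->|v0] := eqVneq v 0.
    by rewrite normr0 mulr0 norm_zero.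
  by case: no; exists v.
pose S : set 'rV[R]_n := [set v | `|v| = 1].
have unitS v : v != 0 -> S (`|v|^-1 *: v).
  by move=> v0; rewrite /S /= (@normrZ R _) normfV normr_id mulVf ?normr_eq0.
have S0 : S !=set0 by exists (`|u|^-1 *: u); exact: unitS.
have Scompact : compact S.
  apply: bounded_closed_compact.
    by exists 1; split => // M M1 v vS; apply: le_trans (ltW M1); rewrite vS.
  have -> : S = (fun v : 'rV[R]_n => `|v|) @^-1` [set 1] by [].
  apply: closed_comp; last exact: closed_eq.
  by move=> v _; exact: norm_continuous.
have [|c cS cmin] := @EVT_min_rV R n N S S0 Scompact.
  by apply: continuous_subspaceT; exact: is_norm_continuous.
move: cS; rewrite inE => cS.
exists (N c).
  rewrite lt_neqAle norm_ge0 andbT; apply/eqP => Nc0.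
  have := norm_definite N_norm (esym Nc0) => c0.
  by move: cS; rewrite /S /= c0 normr0 => /esym/eqP; rewrite oner_eq0.
move=> v; have [->|v0] := eqVneq v 0; first by rewrite normr0 mulr0 norm_zero.
have := cmin (`|v|^-1 *: v); rewrite inE => /(_ (unitS _ v0)).
rewrite (norm_homogeneous N_norm) normfV normr_id mulrC ler_pdivlMr//.
by rewrite normr_gt0.
Qed.

(** Once [v] is scaled to norm 1, its pairing with [g] lies in the set under the supremum. This set
    must first be shown bounded for [sup] to be an upper bound; [sup_le_norm] bounds the entries of
    the vectors in the unit ball. *)
Lemma dotv_le_conjugate_norm g v : dotv g v <= conjugate_norm N g * N v.
Proof.
have [c c0 cN] := sup_le_norm.
have has_supE : has_sup [set dotv g x | x in [set x : 'rV[R]_n | N x <= 1]].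
  split; first by exists (dotv g 0), 0 => //=; rewrite norm_zero.
  exists (\sum_j `|g 0 j| * c^-1) => _ [x /= Nx <-].
  apply: ler_sum => j _; apply: le_trans (ler_norm _) _.
  rewrite normrM ler_wpM2l//; apply: le_trans (ler_coord_norm _ _) _.
  by rewrite -[leRHS]mul1r ler_pdivlMr// mulrC (le_trans (cN x)).
have [v0|v0] := eqVneq (N v) 0.
  by rewrite v0 mulr0 (norm_definite N_norm v0) dotv0r.
have Nv_gt0 : 0 < N v by rewrite lt_neqAle eq_sym v0 norm_ge0.
rewrite -ler_pdivrMr// mulrC -dotvZr.
apply: ub_le_sup; first exact: has_supE.2.
exists ((N v)^-1 *: v) => //=.
by rewrite (norm_homogeneous N_norm) normfV ger0_norm ?norm_ge0// mulVf.
Qed.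

End norm.

(** * First-order inequalities for convex functions *)

Section convex_functions.
Context {R : realType} {n : nat}.
Implicit Types (f h w : 'rV[R]_n -> R) (X : set 'rV[R]_n).

Lemma convex_functionE X f : convex_function X f ->
  forall s x y, 0 <= s <= 1 -> X x -> X y ->
    f (s *: x + (1 - s) *: y) <= s * f x + (1 - s) * f y.
Proof.
move=> cf s x y s01 Xx Xy.
by have := cf (Itv01 (andP s01).1 (andP s01).2) x y; rewrite !inE; exact.
Qed.

Lemma convex_setE X : convex_set X ->
  forall s x y, 0 <= s <= 1 -> X x -> X y -> X (s *: x + (1 - s) *: y).
Proof.
move=> cX s x y s01 Xx Xy.
by have := cX x y (Itv01 (andP s01).1 (andP s01).2); rewrite !inE; exact.
Qed.

Lemma convex_function_sum m (f_ : 'I_m -> 'rV[R]_n -> R) X :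
  (forall i, convex_function X (f_ i)) ->
  convex_function X (fun z => \sum_i f_ i z).
Proof.
move=> cf t x y Xx Xy; rewrite convRE !mulr_sumr -big_split.
by apply: ler_sum => i _; exact: cf.
Qed.

(** The differential is linear, hence determined by its values on the basis vectors, which are the
    entries of [grad]. *)
Lemma derive_dotv f x v : differentiable (f : 'rV[R]_n -> R^o) x ->
  'D_v (f : 'rV[R]_n -> R^o) x = dotv (grad f x) v.
Proof.
move=> df; rewrite (deriveE v df) {1}(row_sum_delta v) linear_sum.
apply: eq_bigr => j _; rewrite linearZ /= mxE mulrC; congr (_ * _).
by rewrite deriveE.
Qed.

Lemma differentiable_sumr m (f_ : 'I_m -> 'rV[R]_n -> R) z :
  (forall i, differentiable (f_ i : 'rV[R]_n -> R^o) z) ->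
  differentiable ((fun z => \sum_i f_ i z) : 'rV[R]_n -> R^o) z.
Proof.
move=> df.
rewrite (_ : (fun z => _) = \sum_i (f_ i : 'rV[R]_n -> R^o)); last first.
  by apply/funext => u; rewrite fct_sumE.
by apply: differentiable_sum => i.
Qed.

Lemma grad_sum m (f_ : 'I_m -> 'rV[R]_n -> R) z :
  (forall i, differentiable (f_ i : 'rV[R]_n -> R^o) z) ->
  grad (fun z => \sum_i f_ i z) z = \sum_i grad (f_ i) z.
Proof.
move=> df; apply/rowP => j; rewrite mxE summxE.
rewrite (_ : (fun z => _) = \sum_i (f_ i : 'rV[R]_n -> R^o)); last first.
  by apply/funext => u; rewrite fct_sumE.
rewrite derive_sum => [|i]; last exact: diff_derivable.
by apply: eq_bigr => i _; rewrite mxE.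
Qed.

(** By convexity the difference quotients along the segment from x to z are at most f z - f x, and
    so is their limit from the right. *)
Lemma convex_grad_le f : convex_function setT f ->
  forall x z : 'rV[R]_n, differentiable (f : 'rV[R]_n -> R^o) x ->
    f x + dotv (grad f x) (z - x) <= f z.
Proof.
move=> cf x z df; rewrite -lerBrDl -derive_dotv//.
have /= dfz := diff_derivable (v := z - x) df.
rewrite /derive cvg_at_rightE//; apply: limr_le.
  by apply/cvg_ex; eexists; apply: cvg_dnbhs_at_right; exact: dfz.
near=> s.
have s_gt0 : 0 < s by near: s; exact: nbhs_right_gt.
have s_le1 : s <= 1 by near: s; exact: nbhs_right_le.
have s01 : 0 <= s <= 1 by rewrite ltW.
have -> : (f \o shift x) (s *: (z - x)) = f (s *: z + (1 - s) *: x).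
  congr f; rewrite -[LHS]/(s *: (z - x) + x).
  by rewrite scalerBr scalerBl scale1r addrAC addrA.
rewrite -[leLHS]/(s^-1 * _) mulrC ler_pdivrMr//.
have := convex_functionE cf s01 (I : setT z) (I : setT x); lra.
Unshelve. all: by end_near. Qed.

(** The subgradient inequality at s z + (1 - s) x is combined with strong convexity there; dividing
    by s and letting s tend to 0 recovers the full modulus. *)
Lemma strongly_convex_subgradient N X (sigma : R) w x g :
  convex_set X -> strongly_convex N X sigma w -> X x ->
  is_subgradient X w x g -> forall z, X z ->
  sigma / 2 * N (z - x) ^+ 2 <= prox_fun w x g z.
Proof.
move=> cX cw Xx gw z Xz.
apply: (@le_of_le_add_small _ _ _ (sigma / 2 * N (z - x) ^+ 2)) => s s01.
have s01' : 0 <= s <= 1 by lra.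
have s_gt0 : 0 < s by lra.
have := cw _ _ _ s01' Xz Xx.
have := gw _ (convex_setE cX s01' Xz Xx).
rewrite (_ : _ - x = s *: (z - x)); last first.
  by rewrite scalerBl scale1r scalerBr addrA addrAC addrK.
rewrite dotvZr /prox_fun => h1 h2.
have : s * (sigma / 2 * (1 - s) * N (z - x) ^+ 2)
    <= s * (w z - w x - dotv g (z - x)) by lra.
by rewrite ler_pM2l//; lra.
Qed.

(** The midpoint of two distinct minimizers would have a smaller value. This makes the iterates
    functions of the draws. *)
Lemma strongly_convex_min_uniq N X (sigma : R) F x1 x2 :
  is_norm N -> convex_set X -> 0 < sigma -> strongly_convex N X sigma F ->
  is_minimizer X F x1 -> is_minimizer X F x2 -> x1 = x2.
Proof.
move=> nN cX s0 cF [X1 m1] [X2 m2].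
have h01 : 0 <= (2^-1 : R) <= 1 by lra.
have := cF _ _ _ h01 X1 X2.
have := m1 _ (convex_setE cX h01 X1 X2); have := m2 _ X1; have := m1 _ X2.
move=> h1 h2 h3 h4.
have : sigma * N (x1 - x2) ^+ 2 <= 0 by lra.
rewrite pmulr_rle0// => N2; apply/eqP; rewrite -subr_eq0; apply/eqP.
apply: (norm_definite nN); apply/eqP; rewrite -sqrf_eq0 eq_le N2.
exact: sqr_ge0.
Qed.

End convex_functions.

(* In terms of the conjugate of f, this is the dual prox-function between the
   dual points grad f u and grad f v (in this order). *)
Definition bregman {R : realType} {n : nat} (f : 'rV[R]_n -> R) u v : R :=
  f u - f v - dotv (grad f v) (u - v).

(** * Bregman distances of a smooth convex function *)

Section smooth_convex.
Context {R : realType} {n : nat} {N : 'rV[R]_n -> R} (N_norm : is_norm N).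
Context {f : 'rV[R]_n -> R} {L : R}.
Hypothesis f_convex : convex_function setT f.
Hypothesis f_diff : forall z, differentiable (f : 'rV[R]_n -> R^o) z.
Hypothesis f_smooth : forall u v,
  conjugate_norm N (grad f u - grad f v) <= L * N (u - v).

Lemma bregman_ge0 u v : 0 <= bregman f u v.
Proof. by rewrite /bregman; have := convex_grad_le f_convex u (f_diff v); lra. Qed.

Lemma dotv_grad_sub_le u v z :
  dotv (grad f u - grad f v) z <= L * N (u - v) * N z.
Proof.
apply: le_trans (dotv_le_conjugate_norm N_norm _ _) _.
by rewrite ler_wpM2r ?norm_ge0.
Qed.

(* Summing the gradient inequality over a subdivision of [v, u] replaces the
   integral of the gradient along the segment. *)
Lemma bregman_le u v : bregman f u v <= L / 2 * N (u - v) ^+ 2.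
Proof.
set d := u - v; set g := grad f v.
(* Induction on the number of steps of length [e]: step j + 1 costs at most e ^+ 2 * (j + 1) times L
   * N d ^+ 2, and the factors 1, ..., j add up to j (j + 1) / 2. *)
have step (e : R) j : 0 <= e ->
    f (v + (e *+ j) *: d) <=
    f v + (e *+ j) * dotv g d + L / 2 * N d ^+ 2 * (e ^+ 2 *+ (j * j.+1)).
  move=> e0; elim: j => [|j IH].
    by rewrite mul0n !mulr0n scale0r mul0r mulr0 !addr0.
  set q := v + (e *+ j.+1) *: d.
  have := convex_grad_le f_convex (v + (e *+ j) *: d) (f_diff q).
  have -> : v + (e *+ j) *: d - q = - (e *: d).
    rewrite /q opprD addrACA subrr add0r -scalerBl mulrS opprD.
    by rewrite addrCA subrr addr0 scaleNr.
  rewrite dotvNr dotvZr => h1.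
  have := dotv_grad_sub_le q v d; rewrite dotvBl -/g.
  have -> : q - v = (e *+ j.+1) *: d by rewrite /q addrAC subrr add0r.
  rewrite (norm_homogeneous N_norm) ger0_norm ?mulrn_wge0// => h2.
  have {h2} := ler_wpM2l e0 h2; move: IH h1.
  rewrite -[e *+ j]mulr_natr -[e *+ j.+1]mulr_natr.
  rewrite -[_ *+ (j * _)]mulr_natr -[_ *+ (j.+1 * _)]mulr_natr !natrM.
  rewrite -(addn1 j.+1) -(addn1 j) !natrD.
  lra.
rewrite /bregman -/g -/d.
apply: (@le_of_le_add_small _ _ _ (`|L / 2 * N d ^+ 2|)) => s /andP[s0 s1].
(* With K + 1 equal steps the quadratic term carries the factor 1 + 1 / (K + 1); [K] is so large
   that the excess is at most s. *)
have [K sK] : exists K : nat, s^-1 < K.+1%:R.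
  exists (Num.truncn s^-1); exact: truncnS_gt.
have := step (K.+1%:R^-1) K.+1; rewrite invr_ge0 ler0n => /(_ isT).
rewrite -[K.+1%:R^-1 *+ K.+1]mulr_natr mulVf ?pnatr_eq0// scale1r mul1r.
rewrite /d [v + _]addrC subrK -/d => h.
have Ks : K.+1%:R^-1 <= s.
  by rewrite -[leRHS]invrK lef_pV2 ?posrE ?invr_gt0 ?ltr0n// ltW.
have {h}: f u - f v - dotv g d <= L / 2 * N d ^+ 2 * (1 + K.+1%:R^-1).
  have -> : 1 + K.+1%:R^-1 = K.+1%:R^-1 ^+ 2 *+ (K.+1 * K.+2) :> R.
    rewrite -[RHS]mulr_natr natrM -(addn1 K.+1) natrD.
    have : K.+1%:R != 0 :> R by rewrite pnatr_eq0.
    by move: (K.+1%:R : R) => q q0; field.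
  by move: h; set T := _ *+ (K.+1 * _); lra.
move=> /le_trans; apply; rewrite mulrDr mulr1 lerD2l mulrC.
apply: (@le_trans _ _ (K.+1%:R^-1 * `|L / 2 * N d ^+ 2|)).
  by rewrite ler_wpM2l ?invr_ge0// ler_norm.
by rewrite ler_wpM2r.
Qed.

(* Minimizing the Bregman distance to v over a step from u yields the
   Fenchel-Young form of cocoercivity. *)
Lemma dotv_grad_sub_le_bregman a b : 0 <= a -> 0 <= b -> L <= 2 * a * b ->
  forall u v z, dotv (grad f u - grad f v) z <= a * bregman f u v + b * N z ^+ 2.
Proof.
move=> a0 b0 Lab u v z.
(* For a = 0 there is no step of length 1 / a, but then L <= 0 and the Lipschitz bound is already
   nonpositive. *)
have [a_eq0|a_neq0] := eqVneq a 0.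
  move: Lab; rewrite a_eq0 mulr0 mul0r mul0r add0r => L0.
  apply: le_trans (dotv_grad_sub_le u v z) _.
  apply: (@le_trans _ _ 0); last by rewrite mulr_ge0 ?sqr_ge0.
  by rewrite -mulrA mulr_le0_ge0// mulr_ge0// norm_ge0.
have a_gt0 : 0 < a by rewrite lt_neqAle eq_sym a_neq0.
have := bregman_ge0 (u - a^-1 *: z) v.
have := bregman_le (u - a^-1 *: z) u.
have -> : u - a^-1 *: z - u = - (a^-1 *: z) by rewrite addrAC subrr add0r.
rewrite (norm_opp N_norm) (norm_sqrZ N_norm) => h1 h2.
have {h1 h2} : a^-1 * dotv (grad f u - grad f v) z
  <= bregman f u v + L / 2 * (a^-1 ^+ 2 * N z ^+ 2).
  by move: h1 h2; rewrite /bregman !dotvE; lra.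
rewrite mulrC ler_pdivrMr// => h; apply: le_trans h _.
have -> : (bregman f u v + L / 2 * (a^-1 ^+ 2 * N z ^+ 2)) * a
  = a * bregman f u v + L / 2 / a * N z ^+ 2 by field.
by rewrite lerD2l ler_wpM2r ?sqr_ge0// ler_pdivrMr//; lra.
Qed.

End smooth_convex.

(** * One iteration of the method *)

(** The variational inequality at [x1] is tested at z and [h] is bounded by its subgradient; the
    terms in [dw0] and [dw1] regroup into the three prox-functions. *)
Lemma prox_step_le (R : realType) n (X : set 'rV[R]_n) h w mu g x0 dw0 eta
    x1 dw1 z :
  prox_step X h w mu g x0 dw0 eta x1 dw1 -> X z ->
  dotv g (x1 - z) + (h x1 + mu * w x1) - (h z + mu * w z)
    <= eta * prox_fun w x0 dw0 z - (mu + eta) * prox_fun w x1 dw1 z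
       - eta * prox_fun w x0 dw0 x1.
Proof.
case=> [_ _ [dh1 dh1_sub opt]] Xz.
have := opt _ Xz; have := dh1_sub _ Xz.
rewrite /prox_fun !dotvE; nra.
Qed.

Section rpdg_step.
Context {R : realType} {n m : nat}.
Variables (X : set 'rV[R]_n) (N : 'rV[R]_n -> R).
Variables (f_ : 'I_m -> 'rV[R]_n -> R) (L_ : 'I_m -> R).
Variables (h w : 'rV[R]_n -> R) (mu : R) (xs : 'rV[R]_n).
Variables (p : 'I_m -> R) (tau eta alpha : R).
Hypothesis X_convex : convex_set X.
Hypothesis N_norm : is_norm N.
Hypothesis f_convex : forall i, convex_function setT (f_ i).
Hypothesis f_diff :
  forall i z, differentiable (f_ i : 'rV[R]_n -> R^o) z.
Hypothesis f_smooth : forall i z1 z2,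
  conjugate_norm N (grad (f_ i) z1 - grad (f_ i) z2) <= L_ i * N (z1 - z2).
Hypothesis w_strongly_convex : strongly_convex N X 1 w.
Hypothesis xs_X : X xs.
Hypothesis p_ge0 : forall i, 0 <= p i.
Hypothesis p_sum1 : \sum_(i < m) p i = 1.
Hypothesis tau_ge0 : 0 <= tau.
Hypothesis eta_ge0 : 0 <= eta.
Hypothesis alpha_gt0 : 0 < alpha.
Hypothesis alpha_lt1 : alpha < 1.
Hypothesis cond_p : forall i, (1 - alpha) * (1 + tau) <= p i.
Hypothesis cond_L : forall i, 4 * L_ i <= eta * tau * p i.

Lemma prob_gt0 i : 0 < p i.
Proof. by apply: lt_le_trans (cond_p i); rewrite mulr_gt0 ?subr_gt0 ?ltr_wpDr. Qed.

Lemma prob_le1 i : p i <= 1.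
Proof. by rewrite -p_sum1 (bigD1 i)//= lerDl sumr_ge0. Qed.

(** In saddle-point terms, the primal gap of the Lagrangian with the dual points frozen at the
    gradients at [xs]. *)
Definition linear_gap z : R :=
  dotv (\sum_i grad (f_ i) xs) (z - xs)
  + (h z + mu * w z) - (h xs + mu * w xs).

(* The last two terms carry the extrapolation error over to the next iteration. *)
Definition potential kap x dw xprev (u : 'I_m -> 'rV[R]_n) : R :=
  kap * prox_fun w x dw xs
  + \sum_i (1 + tau) / p i * bregman (f_ i) (u i) xs
  + dotv (\sum_i grad (f_ i) (u i) - \sum_i grad (f_ i) xs) (x - xprev)
  + eta / 4 * N (x - xprev) ^+ 2.

(** The pairing may be negative. Split over the indices, its i-th part is absorbed by the i-th
    Bregman term and the share p_i of the norm term, by [dotv_grad_sub_le_bregman]; the shares add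
    up since the p_i sum to 1. *)
Lemma potential_ge kap x dw xprev u :
  kap * prox_fun w x dw xs <= potential kap x dw xprev u.
Proof.
rewrite /potential -!addrA lerDl addrA -sumrB.
have : - dotv (\sum_i (grad (f_ i) (u i) - grad (f_ i) xs)) (x - xprev)
  <= \sum_i ((1 + tau) / p i * bregman (f_ i) (u i) xs
             + eta / 4 * p i * N (x - xprev) ^+ 2).
  rewrite dotv_suml -sumrN; apply: ler_sum => i _.
  have p0 := prob_gt0 i.
  rewrite -dotvNr -(norm_opp N_norm); apply: dotv_grad_sub_le_bregman => //.
  - by rewrite divr_ge0 ?addr_ge0// ltW.
  - by rewrite mulr_ge0 ?divr_ge0// ltW.
  - have -> : 2 * ((1 + tau) / p i) * (eta / 4 * p i) = (1 + tau) * eta / 2.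
      by field; rewrite gt_eqF.
    have := mulr_ge0 eta_ge0 tau_ge0 => et0.
    have := ler_piMr et0 (prob_le1 i).
    move: (cond_L i) (eta_ge0) et0; lra.
have -> : \sum_i ((1 + tau) / p i * bregman (f_ i) (u i) xs
    + eta / 4 * p i * N (x - xprev) ^+ 2)
  = \sum_i (1 + tau) / p i * bregman (f_ i) (u i) xs
    + eta / 4 * N (x - xprev) ^+ 2.
  by rewrite big_split -[in RHS](mulr1 (eta / 4)) -p_sum1 mulr_sumr mulr_suml.
lra.
Qed.

(** As xt = uh + tau (uh - u), the three-point identity of Bregman distances accounts for the terms
    with factor tau exactly. What is left, that the distance from [uh] to [xs] is at most the
    pairing with uh - xs, is nonnegativity of the reversed distance. *)
Lemma dual_step i (xt u : 'rV[R]_n)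
    (uh := (1 + tau)^-1 *: (xt + tau *: u)) :
  (1 + tau) * bregman (f_ i) uh xs - tau * bregman (f_ i) u xs
    + tau * bregman (f_ i) u uh
  <= dotv (grad (f_ i) uh - grad (f_ i) xs) (xt - xs).
Proof.
have xtE : xt = uh + tau *: (uh - u).
  rewrite scalerBr addrA -{1}(scale1r uh) -scalerDl scalerA mulfV ?scale1r ?addrK//.
  by rewrite gt_eqF// ltr_wpDr.
have := bregman_ge0 (f_convex i) (f_diff i) xs uh.
rewrite xtE /bregman; set g := grad _ uh; set gs := grad _ xs.
by clearbody g gs uh; rewrite !dotvE; lra.
Qed.

(** Here [d1] is the new primal displacement and [d2] the previous one, brought in by extrapolation.
    After multiplication by p_i each pairing receives half of the budget tau * bregman, with the
    vectors scaled to (1 - p_i) d1 and alpha d2; the bounds (1 - p_i)^2 <= 1 and alpha^2 <= alpha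
    finish. *)
Lemma dual_error_le i (u uh d1 d2 : 'rV[R]_n) :
  - ((p i)^-1 - 1) * dotv (grad (f_ i) uh - grad (f_ i) u) d1
  + alpha * (p i)^-1 * dotv (grad (f_ i) uh - grad (f_ i) u) d2
  <= tau / p i * bregman (f_ i) u uh
     + eta / 4 * N d1 ^+ 2 + eta * alpha / 4 * N d2 ^+ 2.
Proof.
have p0 := prob_gt0 i; have p1 := prob_le1 i.
have a0 : 0 <= tau / 2 by rewrite divr_ge0.
have b0 : 0 <= eta * p i / 4 by rewrite divr_ge0 ?mulr_ge0.
have hL : L_ i <= 2 * (tau / 2) * (eta * p i / 4) by have := cond_L i; lra.
have FY z := dotv_grad_sub_le_bregman N_norm (f_convex i) (@f_diff i)
  (@f_smooth i) a0 b0 hL u uh z.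
have h1 := FY ((1 - p i) *: d1); have h2 := FY (- (alpha *: d2)).
rewrite -[grad (f_ i) uh - _]opprB !dotvNl.
move: h1 h2; rewrite dotvNr !dotvZr (norm_opp N_norm) !(norm_sqrZ N_norm).
set D := bregman _ _ _; set g1 := dotv _ d1; set g2 := dotv _ d2 => h1 h2.
rewrite -(ler_pM2l p0).
have -> : p i * (- ((p i)^-1 - 1) * - g1 + alpha / p i * - g2) =
  (1 - p i) * g1 - alpha * g2 by field; rewrite gt_eqF.
have -> : p i * (tau / p i * D + eta / 4 * N d1 ^+ 2 + eta * alpha / 4 * N d2 ^+ 2)
  = tau * D + eta * p i / 4 * N d1 ^+ 2 + alpha * (eta * p i / 4 * N d2 ^+ 2).
  by field; rewrite gt_eqF.
have q1 : eta * p i / 4 * ((1 - p i) ^+ 2 * N d1 ^+ 2) <= eta * p i / 4 * N d1 ^+ 2.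
  rewrite ler_wpM2l// ler_piMl ?sqr_ge0//.
  by rewrite expr_le1 ?subr_ge0// lerBlDr lerDl ltW.
have q2 : eta * p i / 4 * (alpha ^+ 2 * N d2 ^+ 2)
    <= alpha * (eta * p i / 4 * N d2 ^+ 2).
  have alpha2 : alpha ^+ 2 <= alpha by rewrite expr2 ler_piMl ?ltW.
  by rewrite mulrCA ler_wpM2r// mulr_ge0 ?sqr_ge0.
lra.
Qed.

Lemma sum_update (V : zmodType) (F : 'I_m -> 'rV[R]_n -> V)
    (u uh : 'I_m -> 'rV[R]_n) i :
  \sum_j F j (if j == i then uh j else u j)
  = \sum_j F j (u j) + (F i (uh i) - F i (u i)).
Proof.
rewrite (bigD1 i)//= eqxx [in RHS](bigD1 i)//= addrAC addrCA subrr addr0.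
by congr (_ + _); apply: eq_bigr => j /negbTE ->.
Qed.

(** For each draw i the left side is bounded by a part [A] that does not depend on i plus [rest i].
    Under the weights p_i the factors 1 / p_i cancel, so the gradient differences at all candidate
    points [uh] appear although a draw moves only one of them, and [dual_step] applies to every
    index. *)
Lemma rpdg_potential_le x xprev dw (u x' dw' : 'I_m -> 'rV[R]_n)
    (xt := alpha *: (x - xprev) + x)
    (uh := fun i => (1 + tau)^-1 *: (xt + tau *: u i)) :
  X x -> is_subgradient X w x dw ->
  (forall i, prox_step X h w mu
     (\sum_j grad (f_ j) (u j)
      + (p i)^-1 *: (grad (f_ i) (uh i) - grad (f_ i) (u i)))
     x dw eta (x' i) (dw' i)) ->
  \sum_i p i * (linear_gap (x' i) + potential (mu + eta) (x' i) (dw' i) x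
                  (fun j => if j == i then uh j else u j))
  <= alpha * potential (eta / alpha) x dw xprev u.
Proof.
move=> Xx dw_sub prox.
pose b i := bregman (f_ i) (u i) xs.
pose bh i := bregman (f_ i) (uh i) xs.
pose c i := (1 + tau) / p i.
pose Y := \sum_j grad (f_ j) (u j) - \sum_j grad (f_ j) xs.
pose e i := grad (f_ i) (uh i) - grad (f_ i) (u i).
pose rest i := - dotv (Y + (p i)^-1 *: e i) (xt - xs)
   + tau / p i * bregman (f_ i) (u i) (uh i) + c i * (bh i - b i).
pose A := eta * prox_fun w x dw xs + alpha * dotv Y (x - xprev)
  + eta * alpha / 4 * N (x - xprev) ^+ 2 + \sum_i c i * b i.
have each i : linear_gap (x' i) + potential (mu + eta) (x' i) (dw' i) x
    (fun j => if j == i then uh j else u j) <= A + rest i.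
  rewrite /potential.
  rewrite (sum_update (fun j v => (1 + tau) / p j * bregman (f_ j) v xs)).
  have -> : \sum_j grad (f_ j) (if j == i then uh j else u j)
      - \sum_j grad (f_ j) xs = Y + e i.
    by rewrite /Y /e addrAC (sum_update (fun j v => grad (f_ j) v)).
  have X' : X (x' i) by case: (prox i) => -[].
  have := prox_step_le (prox i) xs_X.
  (* Strong convexity yields eta / 2 times the squared displacement: one half pays for
     [dual_error_le], the other is the carried norm term of the new potential. *)
  have := ler_wpM2l eta_ge0
    (strongly_convex_subgradient X_convex w_strongly_convex Xx dw_sub X').
  have := dual_error_le i (u i) (uh i) (x' i - x) (x - xprev).
  have -> : \sum_j grad (f_ j) (u j) = Y + \sum_j grad (f_ j) xs.
    by rewrite /Y subrK.
  rewrite /linear_gap /A /rest /c /b /bh /xt -/(e i).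
  set gs := \sum_j grad _ xs; set ei := e i; clearbody gs Y ei.
  rewrite !dotvE.
  lra.
apply: (@le_trans _ _ (\sum_i p i * (A + rest i))).
  by apply: ler_sum => i _; rewrite ler_wpM2l.
under eq_bigr do rewrite mulrDr.
rewrite big_split -mulr_suml p_sum1 mul1r /=.
have -> : \sum_i p i * rest i = \sum_i (
    - dotv (grad (f_ i) (uh i) - grad (f_ i) xs) (xt - xs)
    + tau * bregman (f_ i) (u i) (uh i) + (1 + tau) * (bh i - b i)).
  have restE i : p i * rest i = - (p i * dotv Y (xt - xs)) - dotv (e i) (xt - xs)
     + tau * bregman (f_ i) (u i) (uh i) + (1 + tau) * (bh i - b i).
    rewrite /rest dotvDl dotvZl /c; field; rewrite gt_eqF//; exact: prob_gt0.
  rewrite (eq_bigr _ (fun i _ => restE i)) !big_split /=; congr (_ + _ + _).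
  have YE : Y = \sum_i (grad (f_ i) (u i) - grad (f_ i) xs) by rewrite /Y sumrB.
  rewrite [X in X + _](_ : _ = - dotv Y (xt - xs)); last first.
    by rewrite sumrN -mulr_suml p_sum1 mul1r.
  rewrite YE dotv_suml -sumrN -big_split; apply: eq_bigr => i _.
  by rewrite /= -opprD -dotvDl /e addrC addrA subrK.
have alphaE : alpha * potential (eta / alpha) x dw xprev u
   = eta * prox_fun w x dw xs + alpha * dotv Y (x - xprev)
     + eta * alpha / 4 * N (x - xprev) ^+ 2 + \sum_i alpha * (c i * b i).
  rewrite -mulr_sumr /potential -/Y.
  by field; rewrite gt_eqF.
rewrite alphaE /A -addrA lerD2l -big_split; apply: ler_sum => i _ /=.
have hd := dual_step i xt (u i); cbv zeta in hd.
rewrite -/(uh i) -/(b i) -/(bh i) in hd.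
(* The contraction of the dual distances: [cond_p] divided by p_i reads (1 - alpha) * c i <= 1. *)
have : (c i - 1) * b i <= alpha * c i * b i.
  rewrite ler_wpM2r//; first exact: bregman_ge0.
  rewrite lerBlDr -lerBlDl -{1}(mul1r (c i)) -mulrBl /c mulrA.
  by rewrite ler_pdivrMr ?mul1r ?prob_gt0.
lra.
Qed.

End rpdg_step.

(** * Expectation over histories of draws *)

Section history_expectation.
Context {R : realType} {m : nat}.
Variable p : 'I_m -> R.
Implicit Types (F G : seq 'I_m -> R) (s : seq 'I_m) (t : nat).

(* Histories list the draws from the most recent one to the first one. *)
Fixpoint hist_expect t F : R :=
  if t is t'.+1 then hist_expect t' (fun s => \sum_i p i * F (i :: s))
  else F [::].

Lemma eq_hist_expect t F G : (forall s, size s = t -> F s = G s) ->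
  hist_expect t F = hist_expect t G.
Proof.
elim: t F G => [|t IH] F G FG /=; first exact: FG.
by apply: IH => s st; apply: eq_bigr => i _; rewrite FG//= st.
Qed.

Lemma hist_expectD t F G :
  hist_expect t (fun s => F s + G s) = hist_expect t F + hist_expect t G.
Proof.
elim: t F G => [//|t IH] F G /=; rewrite -IH; apply: eq_hist_expect => s _.
by rewrite -big_split; apply: eq_bigr => i _; rewrite mulrDr.
Qed.

Lemma hist_expectZ t a F :
  hist_expect t (fun s => a * F s) = a * hist_expect t F.
Proof.
elim: t F => [//|t IH] F /=; rewrite -IH; apply: eq_hist_expect => s _.
by rewrite mulr_sumr; apply: eq_bigr => i _; rewrite mulrCA.
Qed.

Lemma hist_expect_sum t (I : Type) (r : seq I) (F : I -> seq 'I_m -> R) :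
  hist_expect t (fun s => \sum_(j <- r) F j s)
  = \sum_(j <- r) hist_expect t (F j).
Proof.
elim: r => [|j r IH].
  rewrite big_nil -[RHS](mul0r (hist_expect t (fun=> 0))) -hist_expectZ.
  by apply: eq_hist_expect => s _; rewrite big_nil mul0r.
rewrite big_cons -IH -hist_expectD.
by apply: eq_hist_expect => s _; rewrite big_cons.
Qed.

(** The explicit form, in which the weight of a history can be matched with its probability. *)
Lemma hist_expect_tuple t F :
  hist_expect t F = \sum_(s : t.-tuple 'I_m) (\prod_(i <- s) p i) * F s.
Proof.
elim: t F => [|t IH] F /=.
  rewrite (big_pred1 [tuple]) => [|s]; last first.
    by apply/esym/eqP; apply: val_inj; rewrite /= (tuple0 s).
  by rewrite big_nil mul1r.
rewrite IH.
rewrite (eq_bigr (fun s : t.-tuple 'I_m =>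
    \sum_i (\prod_(j <- s) p j) * (p i * F (i :: s)))) => [|s _]; last first.
  by rewrite mulr_sumr.
rewrite exchange_big pair_big /=.
rewrite (reindex (fun u : 'I_m * t.-tuple 'I_m => [tuple of u.1 :: u.2])) /=.
  by apply: eq_bigr => -[i s] _ /=; rewrite big_cons mulrA (mulrC (p i)).
exists (fun s : t.+1.-tuple 'I_m => (thead s, [tuple of behead s])) => [[i s]|s] _ /=.
  by congr (_, _); apply: val_inj.
by apply: val_inj => /=; case/tupleP: s.
Qed.

Hypothesis p_ge0 : forall i, 0 <= p i.
Hypothesis p_sum1 : \sum_i p i = 1.

Lemma hist_expect_le t F G : (forall s, size s = t -> F s <= G s) ->
  hist_expect t F <= hist_expect t G.
Proof.
elim: t F G => [|t IH] F G FG /=; first exact: FG.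
by apply: IH => s st; apply: ler_sum => i _; rewrite ler_wpM2l// FG//= st.
Qed.

Lemma hist_expect_ge0 t F : (forall s, size s = t -> 0 <= F s) ->
  0 <= hist_expect t F.
Proof.
move=> F0; rewrite -[leLHS](mul0r (hist_expect t F)) -hist_expectZ.
by apply: hist_expect_le => s st; rewrite mul0r F0.
Qed.

(** The draws after the t-th average out because their weights sum to 1. *)
Lemma hist_expect_forget t j F :
  (forall s i, (t <= size s < t + j)%N -> F (i :: s) = F s) ->
  hist_expect (t + j) F = hist_expect t F.
Proof.
elim: j => [|j IH] forget; first by rewrite addn0.
rewrite addnS /= -IH => [|s i /andP[ts sj]]; last first.
  by rewrite forget// ts addnS ltnS ltnW.
apply: eq_hist_expect => s st.
rewrite -[RHS]mul1r -p_sum1 mulr_suml; apply: eq_bigr => i _.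
by rewrite forget// st addnS ltnSn leq_addr.
Qed.

(** Tower property: the last draw is averaged out with the earlier ones fixed, then the one before
    it, and so on. *)
Lemma hist_expect_supermartingale (Z : nat -> seq 'I_m -> R) t :
  (forall s, (size s < t)%N ->
     \sum_i p i * Z (size s).+1 (i :: s) <= Z (size s) s) ->
  hist_expect t (Z t) <= Z 0 [::].
Proof.
elim: t => [//|t IH] super /=; apply: (@le_trans _ _ (hist_expect t (Z t))).
  by apply: hist_expect_le => s st; rewrite -[in X in _ <= X]st -st super// st.
by apply: IH => s st; apply: super; rewrite ltnS ltnW.
Qed.

End history_expectation.

(** * Histories of draws as events *)

Section history.
Context {T S : Type} (i_ : nat -> T -> S).

(** The most recent draw comes first, as in [hist_expect]; draw r thus sits at position t - r. *)
Fixpoint history t o : seq S :=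
  if t is t'.+1 then i_ t o :: history t' o else [::].

Lemma size_history t o : size (history t o) = t.
Proof. by elim: t => //= t ->. Qed.

Lemma history_eqP t o1 o2 : history t o1 = history t o2 <->
  forall r, (1 <= r <= t)%N -> i_ r o1 = i_ r o2.
Proof.
elim: t => [|t IH] /=; first by split=> // _ [].
split=> [[e /IH h] r /andP[r0]|h].
  by rewrite leq_eqVlt => /predU1P[->//|rt]; apply: h; rewrite r0.
congr (_ :: _); first by apply: h; rewrite leqnn.
by apply/IH => r /andP[r0 rt]; apply: h; rewrite r0 leqW.
Qed.

Lemma history_nthP a t o (s : seq S) : size s = t ->
  history t o = s <->
  forall r, (1 <= r <= t)%N -> i_ r o = nth a s (t - r).
Proof.
elim: t s => [|t IH] [|b s] //= => [_|[st]].
  by split=> // _ [].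
split=> [[e /(IH _ st) h] r /andP[r0]|h].
  rewrite leq_eqVlt => /predU1P[->|rt]; first by rewrite subnn.
  by rewrite subSn//= h// r0.
congr (_ :: _); first by rewrite h ?leqnn// subnn.
apply/(IH _ st) => r /andP[r0 rt].
by rewrite h ?r0 ?leqW// subSn.
Qed.

End history.

Section independent_draws.
Context {R : realType} {d : measure_display} {T : measurableType d}.
Variables (Pr : probability T R) (m : nat) (p : 'I_m -> R) (k : nat).
Variable (i_ : nat -> T -> 'I_m).
Hypothesis draws : independent_draws Pr p k i_.
Hypothesis p_gt0 : forall i, 0 < p i.

Let event t s : set T := [set o | history i_ t o = s].

Lemma history_eventE a t s : size s = t ->
  event t s = \bigcap_(r in [set` [fset r in iota 1 t]%fset])
                 (i_ r @^-1` [set nth a s (t - r)]).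
Proof.
move=> st; apply/seteqP; split=> o /=.
  move=> /(history_nthP i_ a o st) h r /=; rewrite in_fset_ mem_iota add1n ltnS.
  exact: h.
move=> h; apply/(history_nthP i_ a o st) => r r1t.
by apply: h => /=; rewrite in_fset_ mem_iota add1n ltnS.
Qed.

Lemma measurable_history t s : (t <= k)%N -> size s = t -> measurable (event t s).
Proof.
case: draws => mi _ _.
(* The empty history is the sure event; a nonempty one supplies the default element that [nth]
   requires. *)
case: s => [|a s] tk st.
  rewrite (_ : event _ _ = setT)//; apply/seteqP; split=> // o _.
  by apply: size0nil; rewrite size_history -st.
rewrite (history_eventE a st).
apply: bigcap_measurableType => r /=; rewrite in_fset_ mem_iota add1n ltnS.
by move=> /andP[r0 rt]; apply: mi; rewrite r0 (leq_trans rt).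
Qed.

(** Independence gives a product over the times 1, ..., t; the history lists the draws in the
    opposite order, hence the reversal. *)
Lemma probability_history t s : (t <= k)%N -> size s = t ->
  Pr (event t s) = (\prod_(i <- s) p i)%:E.
Proof.
case: draws => _ pi indep.
case: s => [|a s] tk st.
  rewrite (_ : event _ _ = setT) ?probability_setT ?big_nil//.
  apply/seteqP; split=> // o _.
  by apply: size0nil; rewrite size_history -st.
rewrite (history_eventE a st) indep; last first.
  move=> r /=; rewrite in_fset_ mem_iota add1n ltnS.
  by move=> /andP[-> rt]; exact: leq_trans tk.
rewrite (perm_big (iota 1 t)); last first.
  by apply: uniq_perm (fset_uniq _) (iota_uniq _ _) _ => r; rewrite in_fset_.
rewrite (eq_big_seq (fun r => (p (nth a (a :: s) (t - r)))%:E)) => [|r]; last first.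
  rewrite mem_iota add1n ltnS => /andP[r0 rt].
  by rewrite pi// r0 (leq_trans rt).
rewrite prodEFin; congr EFin.
rewrite -(big_map (fun r => nth a (a :: s) (t - r)) predT p).
rewrite -[RHS](perm_big _ (permEl (perm_rev (a :: s)))).
congr bigop; apply: (@eq_from_nth _ a).
  by rewrite size_map size_iota size_rev.
move=> j; rewrite size_map size_iota => jt.
by rewrite (nth_map 0%N) ?size_iota// nth_iota// nth_rev st// add1n.
Qed.

(** A function of the first t draws is a finite combination of indicators of history events, so its
    integral is the weighted sum over histories. *)
Lemma expectation_history t F : (t <= k)%N ->
  ('E_Pr[fun o => F (history i_ t o)] = (hist_expect p t F)%:E)%E.
Proof.
move=> tk; rewrite hist_expect_tuple.
have FE o : F (history i_ t o)
    = \sum_(s : t.-tuple 'I_m) F s * \1_(event t s) o.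
  have hs : size (history i_ t o) == t by rewrite size_history.
  rewrite (bigD1 (Tuple hs))//= big1 ?addr0 => [|s sne].
    by rewrite indicE mem_set ?mulr1.
  rewrite indicE memNset ?mulr0// => e; move: sne.
  by rewrite -val_eqE /= e eqxx.
rewrite unlock; under eq_integral do rewrite FE -sumEFin.
have mev (s : t.-tuple 'I_m) : measurable (event t s).
  by apply: measurable_history; rewrite ?size_tuple.
rewrite integral_sum//=.
  rewrite -sumEFin; apply: eq_bigr => s _.
  under eq_integral do rewrite EFinM.
  rewrite integralZl//=; last exact: integrable_indic.
  have := expectation_indic Pr (mev s).
  rewrite unlock probability_history ?size_tuple// => ->.
  by rewrite -EFinM mulrC.
move=> s; under [X in integrable _ _ X]eq_fun do rewrite EFinM.
by apply: integrableZl => //; exact: integrable_indic.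
Qed.

(** A history of length at most k has positive probability, so its event is nonempty.
    Representatives turn random variables that depend on the history alone into functions of
    lists. *)
Lemma history_representative : exists rep : seq 'I_m -> T,
  forall s, (size s <= k)%N -> history i_ (size s) (rep s) = s.
Proof.
suff [rep repP] : {rep : seq 'I_m -> T & forall s,
    (size s <= k)%N -> history i_ (size s) (rep s) = s} by exists rep.
apply: (@choice _ _ (fun s o => (size s <= k)%N -> history i_ (size s) o = s)).
have ex s : (size s <= k)%N -> exists o, history i_ (size s) o = s.
  move=> sk; apply: contrapT => no.
  have := probability_history sk erefl.
  rewrite (_ : event _ _ = set0).
    rewrite measure0 => /eqP; rewrite eqe eq_sym => /negPn/negP; apply.
    by rewrite gt_eqF// prodr_gt0.
  by apply/seteqP; split=> // o oe; apply: no; exists o.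
move=> s; have [sk|ks] := leqP (size s) k.
  by have [w sw] := ex s sk; exists w.
(* Beyond length k any outcome will do; the sure event provides one. *)
have [w _] := ex [::] isT.
by exists w.
Qed.

End independent_draws.

(** * Ergodic means and the primal gap *)

Lemma bernoulli_le (R : realFieldType) (a : R) t : 0 <= a ->
  1 + a *+ t <= (1 + a) ^+ t.
Proof.
move=> a0; elim: t => [|t IH]; first by rewrite mulr0n expr0 addr0.
rewrite exprS.
apply: le_trans (ler_wpM2l (_ : 0 <= 1 + a) IH); last by rewrite addr_ge0.
rewrite mulrS mulrDl mul1r mulrDr mulr1 addrA (addrAC 1) addrA lerDl.
by rewrite mulr_ge0 ?mulrn_wge0.
Qed.

Section geometric_weights.
Context {R : realType}.
Variable alpha : R.
Hypotheses (alpha_gt0 : 0 < alpha) (alpha_lt1 : alpha < 1).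
Local Notation Theta k := (\sum_(1 <= t < k.+1) alpha ^- t).

Lemma geometric_sum_ge k : (1 <= k)%N -> alpha ^- k <= Theta k.
Proof.
case: k => // k _; rewrite big_nat_recr //= lerDr.
by apply: sumr_ge0 => t _; rewrite invr_ge0 exprn_ge0// ltW.
Qed.

Lemma geometric_sum_gt0 k : (1 <= k)%N -> 0 < Theta k.
Proof.
move=> k1; apply: lt_le_trans (geometric_sum_ge k1).
by rewrite invr_gt0 exprn_gt0.
Qed.

(** Absorbs the factor k produced by summing k equal error terms. With q the square root of alpha,
    the induction step needs k + 1 <= q k + q^-(k+1), which is Bernoulli's inequality for q^-1
    together with 1 - q <= q^-1 - 1. *)
Lemma le_powR_geometric_sum k : k%:R <= alpha `^ (k%:R / 2) * Theta k.
Proof.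
pose q := Num.sqrt alpha.
have q0 : 0 < q by rewrite sqrtr_gt0.
have q1 : q < 1 by rewrite -sqrtr1 ltr_sqrt.
have alphaE : alpha = q ^+ 2 by rewrite sqr_sqrtr// ltW.
have -> : alpha `^ (k%:R / 2) = q ^+ k.
  by rewrite mulrC powRrM powR12_sqrt ?ltW// powR_mulrn ?sqrtr_ge0.
rewrite alphaE; elim: k => [|k IH]; first by rewrite big_geq// mulr0.
rewrite big_nat_recr //= mulrDr exprS -mulrA.
have -> : q * q ^+ k * (q ^+ 2) ^- k.+1 = q^-1 ^+ k.+1.
  rewrite -exprS -exprM mulnC exprM -[X in X / _]invrK -invfM mulrC.
  by rewrite expr2 mulfK ?exprVn// expf_neq0// gt_eqF.
have h1 : q * k%:R <= q * (q ^+ k * \sum_(1 <= t < k.+1) (q ^+ 2) ^- t).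
  by rewrite ler_wpM2l// ltW.
have qV : 0 <= q^-1 - 1 by rewrite subr_ge0 invf_ge1// ltW.
have := bernoulli_le k.+1 qV; rewrite [1 + (q^-1 - 1)]addrC subrK => h2.
have h3 : 1 - q <= q^-1 - 1.
  have -> : q^-1 - 1 = (1 - q) * q^-1 by rewrite mulrBl mul1r divff ?gt_eqF.
  by rewrite ler_peMr ?subr_ge0 ?ltW// invf_gt1.
have h4 : k%:R * (1 - q) <= k%:R * (q^-1 - 1) by rewrite ler_wpM2l.
move: h2; rewrite -mulr_natl -natr1 => h2.
rewrite natr1 -natr1; lra.
Qed.

End geometric_weights.

(** Jensen's inequality by induction: adding a point replaces the mean by a convex combination of
    the old mean, with weight [s], and the new point. *)
Lemma ergodic_mean_le (R : realType) n (X : set 'rV[R]_n) (Phi : 'rV[R]_n -> R)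
    (theta : nat -> R) (x : nat -> 'rV[R]_n) k :
  convex_set X ->
  (forall s a b, 0 <= s <= 1 -> X a -> X b ->
     Phi (s *: a + (1 - s) *: b) <= s * Phi a + (1 - s) * Phi b) ->
  (forall t, 0 < theta t) -> (forall t, (1 <= t <= k)%N -> X (x t)) ->
  (1 <= k)%N ->
  X (ergodic_mean theta x k) /\
  Phi (ergodic_mean theta x k)
    <= (\sum_(1 <= t < k.+1) theta t)^-1 *
       \sum_(1 <= t < k.+1) theta t * Phi (x t).
Proof.
move=> cX cPhi th0; case: k => // k xX _; elim: k xX => [|k IH] xX.
  rewrite /ergodic_mean !big_nat1 scalerA mulrA mulVf ?gt_eqF// scale1r mul1r.
  by split; [exact: xX|].
have [|Xm IHm] := IH; first by move=> t /andP[t1 tk]; apply: xX; rewrite t1 leqW.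
have Xk : X (x k.+2) by apply: xX; rewrite /= leqnn.
set A := \sum_(1 <= t < k.+2) theta t in Xm IHm *.
have A0 : 0 < A.
  rewrite /A big_nat_recr //= ltr_wpDl// sumr_ge0// => t _; exact: ltW.
have AE : \sum_(1 <= t < k.+3) theta t = A + theta k.+2 by rewrite big_nat_recr.
have B0 : 0 < A + theta k.+2 by rewrite addr_gt0.
pose s := A / (A + theta k.+2).
have s01 : 0 <= s <= 1.
  apply/andP; split; first by rewrite divr_ge0// ltW.
  by rewrite ler_pdivrMr// mul1r lerDl ltW.
have s1E : 1 - s = theta k.+2 / (A + theta k.+2).
  by rewrite /s; field; rewrite gt_eqF.
have -> : ergodic_mean theta x k.+2
    = s *: ergodic_mean theta x k.+1 + (1 - s) *: x k.+2.
  rewrite /ergodic_mean -/A AE s1E [\sum_(1 <= t < k.+3) _]big_nat_recr //=.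
  rewrite scalerDr !scalerA /s; congr (_ *: _ + _ *: _); last exact: mulrC.
  by field; rewrite !gt_eqF.
split; first exact: convex_setE.
apply: le_trans (cPhi _ _ _ s01 Xm Xk) _.
rewrite AE [\sum_(1 <= t < k.+3) _]big_nat_recr //= mulrDr mulrA.
rewrite s1E lerD//; last by rewrite mulrAC mulrC mulrA.
apply: le_trans (ler_wpM2l (andP s01).1 IHm) _.
rewrite le_eqVlt; apply/orP; left; apply/eqP.
by rewrite /s; field; rewrite !gt_eqF.
Qed.

(** * The objective gap against the linearized gap *)

Section primal_gap.
Context {R : realType} {n m : nat}.
Variables (X : set 'rV[R]_n) (N : 'rV[R]_n -> R).
Variables (f_ : 'I_m -> 'rV[R]_n -> R) (Lf : R).
Variables (h w : 'rV[R]_n -> R) (mu : R) (xs : 'rV[R]_n).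
Let f z := \sum_(i < m) f_ i z.
Let Psi z := f z + h z + mu * w z.
Hypothesis X_convex : convex_set X.
Hypothesis N_norm : is_norm N.
Hypothesis f_convex : forall i, convex_function setT (f_ i).
Hypothesis f_diff :
  forall i z, differentiable (f_ i : 'rV[R]_n -> R^o) z.
Hypothesis Lf_ge0 : 0 <= Lf.
Hypothesis Lf_smooth : forall z1 z2,
  conjugate_norm N (grad f z1 - grad f z2) <= Lf * N (z1 - z2).
Hypothesis h_convex : convex_function X h.
Hypothesis w_strongly_convex : strongly_convex N X 1 w.
Hypothesis mu_gt0 : 0 < mu.
Hypothesis xs_opt : is_minimizer X Psi xs.

Local Notation gap := (linear_gap f_ h w mu xs).

(** The sum is the Bregman distance of [f] itself, so the constant is that of [f] and not the sum of
    the individual ones. *)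
Lemma sum_bregman_le u v :
  \sum_i bregman (f_ i) u v <= Lf / 2 * N (u - v) ^+ 2.
Proof.
have fc : convex_function setT f by exact: convex_function_sum.
have fd z : differentiable (f : 'rV[R]_n -> R^o) z by exact: differentiable_sumr.
have := bregman_le N_norm fc fd Lf_smooth u v.
rewrite /bregman /f (grad_sum (fun i => f_diff i v)) dotv_suml.
by rewrite -!sumrB.
Qed.

Lemma objective_gap_le z :
  Psi z - Psi xs <= gap z + Lf / 2 * N (z - xs) ^+ 2.
Proof.
have := sum_bregman_le z xs.
rewrite /bregman /linear_gap /Psi /f !sumrB -dotv_suml; lra.
Qed.

Lemma norm_sqr_convex s a b : 0 <= s <= 1 ->
  N (s *: a + (1 - s) *: b) ^+ 2 <= s * N a ^+ 2 + (1 - s) * N b ^+ 2.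
Proof.
move=> /andP[s0 s1]; have s1' : 0 <= 1 - s by rewrite subr_ge0.
have le1 : N (s *: a + (1 - s) *: b) <= s * N a + (1 - s) * N b.
  apply: le_trans (norm_triangle N_norm _ _) _.
  by rewrite !(norm_homogeneous N_norm) !ger0_norm.
apply: le_trans (_ : (s * N a + (1 - s) * N b) ^+ 2 <= _).
  by rewrite ler_sqr ?nnegrE ?norm_ge0// addr_ge0// mulr_ge0// norm_ge0.
have : 0 <= s * (1 - s) * (N a - N b) ^+ 2 by rewrite mulr_ge0 ?sqr_ge0// mulr_ge0.
lra.
Qed.

Lemma linear_gap_convex s a b : 0 <= s <= 1 -> X a -> X b ->
  gap (s *: a + (1 - s) *: b) <= s * gap a + (1 - s) * gap b.
Proof.
move=> s01 Xa Xb.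
have hh := convex_functionE h_convex s01 Xa Xb.
have hw : w (s *: a + (1 - s) *: b) <= s * w a + (1 - s) * w b.
  apply: le_trans (w_strongly_convex s01 Xa Xb) _.
  case/andP: s01 => s0 s1.
  by rewrite lerBlDr lerDl mulr_ge0 ?sqr_ge0// !mulr_ge0 ?subr_ge0.
have {hw} := ler_wpM2l (ltW mu_gt0) hw.
rewrite /linear_gap; set g := \sum_i _; clearbody g.
have -> : s *: a + (1 - s) *: b - xs = s *: (a - xs) + (1 - s) *: (b - xs).
  rewrite !scalerBr addrACA -opprD -scalerDl.
  by rewrite [s + _]addrC subrK scale1r.
rewrite dotvDr !dotvZr; lra.
Qed.

Lemma linear_gap_opt : gap xs = 0.
Proof. by rewrite /linear_gap subrr dotv0r add0r subrr. Qed.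

(** First-order optimality of [xs]: at the point s z + (1 - s) xs the objective gap is nonnegative
    and at most s * gap z plus a term of order s^2; divide by s and let s tend to 0. *)
Lemma linear_gap_ge0 z : X z -> 0 <= gap z.
Proof.
case: xs_opt => Xs opt Xz.
apply: (@le_of_le_add_small _ _ _ (Lf / 2 * N (z - xs) ^+ 2)) => s s01.
have s01' : 0 <= s <= 1 by lra.
have s0 : 0 < s by lra.
have := objective_gap_le (s *: z + (1 - s) *: xs).
have := linear_gap_convex s01' Xz Xs; rewrite linear_gap_opt mulr0 addr0.
have := opt _ (convex_setE X_convex s01' Xz Xs); rewrite -subr_ge0.
have -> : s *: z + (1 - s) *: xs - xs = s *: (z - xs).
  by rewrite scalerBl scale1r scalerBr addrA addrAC addrK.
rewrite (norm_sqrZ N_norm) => h1 h2 h3.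
have : 0 <= s * (gap z + s * (Lf / 2 * N (z - xs) ^+ 2)) by lra.
by rewrite pmulr_rge0.
Qed.

(** Jensen's inequality for the convex majorant of [objective_gap_le]. *)
Lemma ergodic_gap_le theta (x : nat -> 'rV[R]_n) k :
  (forall t, 0 < theta t) -> (forall t, (1 <= t <= k)%N -> X (x t)) ->
  (1 <= k)%N ->
  Psi (ergodic_mean theta x k) - Psi xs <=
  (\sum_(1 <= t < k.+1) theta t)^-1 *
    \sum_(1 <= t < k.+1) theta t * (gap (x t) + Lf / 2 * N (x t - xs) ^+ 2).
Proof.
move=> th0 xX k1; apply: le_trans (objective_gap_le _) _.
apply: (ergodic_mean_le (X := X)
  (Phi := fun z => gap z + Lf / 2 * N (z - xs) ^+ 2) X_convex _ th0 xX k1).2.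
move=> s a b s01 Xa Xb.
have := linear_gap_convex s01 Xa Xb.
have L2 : 0 <= Lf / 2 by rewrite divr_ge0.
have := ler_wpM2l L2 (norm_sqr_convex (a - xs) (b - xs) s01).
have -> : s *: a + (1 - s) *: b - xs = s *: (a - xs) + (1 - s) *: (b - xs).
  rewrite !scalerBr addrACA -opprD -scalerDl.
  by rewrite [s + _]addrC subrK scale1r.
lra.
Qed.

End primal_gap.

(** * Convergence *)

Section rpdg_convergence.
Context {R : realType} {n m : nat}.
Variables (X : set 'rV[R]_n) (N : 'rV[R]_n -> R).
Variables (f_ : 'I_m -> 'rV[R]_n -> R) (L_ : 'I_m -> R) (Lf : R).
Variables (h w : 'rV[R]_n -> R) (mu : R) (xs : 'rV[R]_n).
Variables (p : 'I_m -> R) (tau eta alpha : R) (tau_ eta_ alpha_ : nat -> R).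
Variables (k : nat) (x0 dw0 : 'rV[R]_n).
Context {d : measure_display} {T : measurableType d}.
Variables (i_ : nat -> T -> 'I_m) (x dw : nat -> T -> 'rV[R]_n).
Variables (xu y yt : nat -> T -> 'I_m -> 'rV[R]_n).
Let f z := \sum_(i < m) f_ i z.
Let Psi z := f z + h z + mu * w z.
Hypothesis X_convex : convex_set X.
Hypothesis N_norm : is_norm N.
Hypothesis f_convex : forall i, convex_function setT (f_ i).
Hypothesis f_diff :
  forall i z, differentiable (f_ i : 'rV[R]_n -> R^o) z.
Hypothesis f_smooth : forall i z1 z2,
  conjugate_norm N (grad (f_ i) z1 - grad (f_ i) z2) <= L_ i * N (z1 - z2).
Hypothesis Lf_ge0 : 0 <= Lf.
Hypothesis Lf_smooth : forall z1 z2,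
  conjugate_norm N (grad f z1 - grad f z2) <= Lf * N (z1 - z2).
Hypothesis Lf_le : forall z1 z2,
  Lf * N (z1 - z2) <= (\sum_(i < m) L_ i) * N (z1 - z2).
Hypothesis h_convex : convex_function X h.
Hypothesis w_strongly_convex : strongly_convex N X 1 w.
Hypothesis mu_gt0 : 0 < mu.
Hypothesis xs_opt : is_minimizer X Psi xs.
Hypothesis p_ge0 : forall i, 0 <= p i.
Hypothesis p_sum1 : \sum_(i < m) p i = 1.
Hypothesis tau_cst : forall t, (1 <= t)%N -> tau_ t = tau.
Hypothesis eta_cst : forall t, (1 <= t)%N -> eta_ t = eta.
Hypothesis alpha_cst : forall t, (1 <= t)%N -> alpha_ t = alpha.
Hypothesis tau_ge0 : 0 <= tau.
Hypothesis eta_ge0 : 0 <= eta.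
Hypothesis alpha_gt0 : 0 < alpha.
Hypothesis alpha_lt1 : alpha < 1.
Hypothesis cond_p : forall i, (1 - alpha) * (1 + tau) <= p i.
Hypothesis cond_eta : eta <= alpha * (mu + eta).
Hypothesis cond_L : forall i, 4 * L_ i <= eta * tau * p i.
Hypothesis x0_X : X x0.
Hypothesis dw0_sub : is_subgradient X w x0 dw0.
Hypothesis dw_nonanticipating : nonanticipating k i_ dw.
Hypothesis run : forall o : T,
  rpdg_run X f_ h w mu p tau_ eta_ alpha_ k x0 dw0 (i_ ^~ o)
    (x ^~ o) (dw ^~ o) (xu ^~ o) (y ^~ o) (yt ^~ o).

Local Notation gap := (linear_gap f_ h w mu xs).
Local Notation pot := (potential N f_ w xs p tau eta).

Let Xs : X xs. Proof. by case: xs_opt. Qed.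

(** * The iterates as functions of the draws *)

Lemma run_X t o : (t <= k)%N -> X (x t o).
Proof.
case: t => [_|t tk]; first by rewrite (run_x0 (run o)).
by case: (run_prox (run o) tk) => -[].
Qed.

Lemma run_subgradient t o : (t <= k)%N -> is_subgradient X w (x t o) (dw t o).
Proof.
case: t => [_|t tk]; first by rewrite (run_x0 (run o)) (run_dw0 (run o)).
by case: (run_prox (run o) tk).
Qed.

Lemma run_prox_fun_ge t o : (t <= k)%N ->
  1 / 2 * N (xs - x t o) ^+ 2 <= prox_fun w (x t o) (dw t o) xs.
Proof.
move=> tk; apply: (strongly_convex_subgradient X_convex w_strongly_convex) => //.
  exact: run_X.
exact: run_subgradient.
Qed.

Lemma run_prox_fun_ge0 t o : (t <= k)%N ->
  0 <= prox_fun w (x t o) (dw t o) xs.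
Proof.
move=> tk; apply: le_trans (run_prox_fun_ge o tk).
by rewrite mulr_ge0 ?sqr_ge0// divr_ge0.
Qed.

Lemma run_y t o i : (t <= k)%N -> y t o i = grad (f_ i) (xu t o i).
Proof.
elim: t => [_|t IH tk]; first by rewrite (run_y0 (run o)) (run_xu0 (run o)).
have [e|ne] := eqVneq i (i_ t.+1 o).
  by case: (run_drawn (run o) tk e).
have [-> -> _] := run_not_drawn (run o) tk (elimN eqP ne).
by apply: IH; exact: ltnW.
Qed.

(** The point that index i would receive if drawn next; it is needed for every i because the
    analysis averages over the draw. *)
Definition next_point t o i : 'rV[R]_n :=
  (1 + tau)^-1 *:
    ((alpha *: (x t o - x t.-1 o) + x t o) + tau *: xu t o i).

Lemma run_xu t o : (t < k)%N ->
  xu t.+1 o = fun i => if i == i_ t.+1 o then next_point t o i else xu t o i.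
Proof.
move=> tk; apply/funext => i; case: eqVneq => [e|ne].
  have [-> _ _] := run_drawn (run o) tk e.
  by rewrite /extrapolation tau_cst// alpha_cst.
by have [-> _ _] := run_not_drawn (run o) tk (elimN eqP ne).
Qed.

Lemma run_yt t o (i := i_ t.+1 o) : (t < k)%N ->
  \sum_j yt t.+1 o j = \sum_j grad (f_ j) (xu t o j)
    + (p i)^-1 *: (grad (f_ i) (next_point t o i) - grad (f_ i) (xu t o i)).
Proof.
move=> tk; rewrite (bigD1 i)//= [in RHS](bigD1 i)//= addrAC; congr (_ + _).
  have [xE yE ->] := run_drawn (run o) tk (erefl i).
  rewrite [RHS]addrC (run_y o i tk) (run_y o i (ltnW tk)) (run_xu o tk).
  by rewrite eqxx.
apply: eq_bigr => j ne.
have [_ _ ->] := run_not_drawn (run o) tk (elimN eqP ne).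
by rewrite run_y// ltnW.
Qed.

Lemma run_prox_step t o (i := i_ t.+1 o) : (t < k)%N ->
  prox_step X h w mu (\sum_j grad (f_ j) (xu t o j)
    + (p i)^-1 *: (grad (f_ i) (next_point t o i) - grad (f_ i) (xu t o i)))
    (x t o) (dw t o) eta (x t.+1 o) (dw t.+1 o).
Proof.
by move=> tk; have := run_prox (run o) tk; rewrite run_yt// eta_cst.
Qed.

(** The term [mu * w] supplies the modulus. As it is positive, the prox-mapping has a single
    value. *)
Lemma prox_objective_strongly_convex g z dz :
  strongly_convex N X mu
    (fun v => dotv g v + h v + mu * w v + eta * prox_fun w z dz v).
Proof.
move=> s a b s01 Xa Xb.
have hh := convex_functionE h_convex s01 Xa Xb.
have hw := w_strongly_convex s01 Xa Xb.
have hN : 0 <= 1 / 2 * s * (1 - s) * N (a - b) ^+ 2.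
  case/andP: s01 => s0 s1.
  by rewrite mulr_ge0 ?sqr_ge0// !mulr_ge0 ?subr_ge0// divr_ge0.
have hw' : w (s *: a + (1 - s) *: b) <= s * w a + (1 - s) * w b.
  by apply: le_trans hw _; rewrite lerBlDr lerDl.
have {hw} := ler_wpM2l (ltW mu_gt0) hw.
have {hw'} := ler_wpM2l eta_ge0 hw'.
rewrite /prox_fun !dotvE; lra.
Qed.

Lemma run_nonanticipating t o1 o2 : (t <= k)%N ->
  history i_ t o1 = history i_ t o2 ->
  [/\ x t o1 = x t o2, dw t o1 = dw t o2, xu t o1 = xu t o2
    & x t.-1 o1 = x t.-1 o2].
Proof.
elim: t => [_ _|t IH tk /= [eqi eqh]].
  rewrite !(run_x0 (run _)) !(run_dw0 (run _)); split=> //.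
  by apply/funext => i; rewrite !(run_xu0 (run _)).
have [ex edw exu exp] := IH (ltnW tk) eqh.
have enext : next_point t o1 = next_point t o2.
  by apply/funext => i; rewrite /next_point ex exu exp.
have exu' : xu t.+1 o1 = xu t.+1 o2 by rewrite !run_xu// enext exu eqi.
(* Optimality does not determine the selected subgradient, so here the nonanticipation hypothesis
   enters; the point itself is unique by strong convexity. *)
have edw' : dw t.+1 o1 = dw t.+1 o2.
  by apply: dw_nonanticipating => //; apply/history_eqP => /=; rewrite eqi eqh.
split=> //.
have [min1 _ _] := run_prox_step o1 tk; have [min2 _ _] := run_prox_step o2 tk.
move: min1; rewrite ex edw exu enext eqi => min1.
exact: (strongly_convex_min_uniq N_norm X_convex mu_gt0
  (@prox_objective_strongly_convex _ _ _) min1 min2).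
Qed.

(** An iteration leaves the weight mu + eta, and the next one starts from eta / alpha, which
    [cond_eta] makes no larger. At time 0 the smaller weight is taken, which keeps mu out of the
    initial bound. *)
Definition potential_weight t : R := if t is 0%N then eta / alpha else mu + eta.

Lemma potential_weight_ge t : eta / alpha <= potential_weight t.
Proof. by case: t => //= _; rewrite ler_pdivrMr// mulrC. Qed.

Definition rpdg_process t o : R :=
  \sum_(1 <= r < t.+1) alpha ^- r * gap (x r o)
  + alpha ^- t * pot (potential_weight t) (x t o) (dw t o) (x t.-1 o) (xu t o).

Lemma run_gap_history t o1 o2 : (t <= k)%N ->
  history i_ t o1 = history i_ t o2 ->
  \sum_(1 <= r < t.+1) alpha ^- r * gap (x r o1)
  = \sum_(1 <= r < t.+1) alpha ^- r * gap (x r o2).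
Proof.
move=> tk /history_eqP hist; apply: eq_big_nat => r /andP[r1 rt].
have [-> //] : [/\ x r o1 = x r o2, dw r o1 = dw r o2, xu r o1 = xu r o2
    & x r.-1 o1 = x r.-1 o2].
apply: run_nonanticipating; first exact: leq_trans tk.
apply/history_eqP => q /andP[q1 qr].
by apply: hist; rewrite q1 (leq_trans qr).
Qed.

(** Conditional expectation given the first t draws, expressed by outcomes: [o_ i] shares these
    draws with [o] and draws i next. The past gaps are common to all of them, and
    [rpdg_potential_le] handles the new terms. *)
Lemma rpdg_process_step t o (o_ : 'I_m -> T) : (t < k)%N ->
  (forall i, history i_ t (o_ i) = history i_ t o) ->
  (forall i, i_ t.+1 (o_ i) = i) ->
  \sum_i p i * rpdg_process t.+1 (o_ i) <= rpdg_process t o.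
Proof.
move=> tk hist drawn; have tk' := ltnW tk.
pose S := \sum_(1 <= r < t.+1) alpha ^- r * gap (x r o).
have procE i : rpdg_process t.+1 (o_ i) = S + alpha ^- t.+1 *
    (gap (x t.+1 (o_ i)) + pot (mu + eta) (x t.+1 (o_ i)) (dw t.+1 (o_ i)) (x t o)
      (fun j => if j == i then next_point t o j else xu t o j)).
  have [ex edw exu exp] := run_nonanticipating tk' (hist i).
  rewrite /rpdg_process big_nat_recr //= -addrA -mulrDr.
  rewrite [X in X + _](run_gap_history tk' (hist i)) ex (run_xu _ tk) drawn.
  have -> : next_point t (o_ i) = next_point t o.
    by apply/funext => j; rewrite /next_point ex exu exp.
  by rewrite exu.
under eq_bigr do rewrite procE mulrDr mulrCA.
rewrite big_split -mulr_suml p_sum1 mul1r -mulr_sumr lerD2l /=.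
have step : \sum_i p i * (gap (x t.+1 (o_ i))
    + pot (mu + eta) (x t.+1 (o_ i)) (dw t.+1 (o_ i)) (x t o)
      (fun j => if j == i then next_point t o j else xu t o j))
  <= alpha * pot (eta / alpha) (x t o) (dw t o) (x t.-1 o) (xu t o).
  apply: (rpdg_potential_le X_convex N_norm f_convex f_diff f_smooth
    w_strongly_convex Xs p_ge0 p_sum1 tau_ge0 eta_ge0 alpha_gt0 alpha_lt1
    cond_p cond_L (run_X o tk') (run_subgradient o tk')) => i.
  have := run_prox_step (o_ i) tk; rewrite drawn.
  have [ex edw exu exp] := run_nonanticipating tk' (hist i).
  by rewrite /next_point ex edw exu exp.
have aV : 0 <= alpha ^- t.+1 by rewrite invr_ge0 exprn_ge0// ltW.
apply: le_trans (ler_wpM2l aV step) _.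
rewrite mulrA exprSr invfM mulfVK ?gt_eqF//.
rewrite ler_wpM2l//; first by rewrite invr_ge0 exprn_ge0// ltW.
rewrite /potential !lerD2r ler_wpM2r ?run_prox_fun_ge0//.
exact: potential_weight_ge.
Qed.

(** [C] is the constant of the initial potential and 1 + [K] the factor of the first bound; C = (eta
    / alpha) (1 + K) when eta is nonzero. *)
Local Notation C := (eta / alpha + Lf / (1 - alpha)).
Local Notation K := (Lf * alpha / ((1 - alpha) * eta)).
Local Notation P0 := (prox_fun w x0 dw0 xs).

Lemma prox_fun0_ge : 1 / 2 * N (xs - x0) ^+ 2 <= P0.
Proof. exact: (strongly_convex_subgradient X_convex w_strongly_convex). Qed.

Lemma prox_fun0_ge0 : 0 <= P0.
Proof.
by apply: le_trans prox_fun0_ge; rewrite mulr_ge0 ?sqr_ge0// divr_ge0.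
Qed.

(** Both displacement terms vanish as the index -1 is truncated to 0. By [cond_p] the dual weights
    are at most 1 / (1 - alpha), and the sum of Bregman distances is at most Lf * P0 by strong
    convexity. *)
Lemma rpdg_process0_le o : rpdg_process 0 o <= C * P0.
Proof.
rewrite /rpdg_process big_geq// add0r expr0 invr1 mul1r /potential /=.
rewrite subrr dotv0r (norm_zero N_norm) expr0n /= mulr0 !addr0.
rewrite (run_x0 (run o)) (run_dw0 (run o)) mulrDl lerD2l.
have alpha1 : 0 < 1 - alpha by rewrite subr_gt0.
apply: (@le_trans _ _ ((1 - alpha)^-1 * \sum_i bregman (f_ i) x0 xs)).
  rewrite mulr_sumr; apply: ler_sum => i _.
  rewrite (run_xu0 (run o)) ler_wpM2r ?bregman_ge0//.
  rewrite ler_pdivrMr ?(prob_gt0 tau_ge0 alpha_lt1 cond_p)// mulrC.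
  by rewrite ler_pdivlMr// mulrC.
rewrite [Lf / _]mulrC -mulrA ler_wpM2l//; first by rewrite invr_ge0 ltW.
apply: le_trans (sum_bregman_le N_norm f_convex f_diff Lf_smooth _ _) _.
rewrite -(norm_opp N_norm) opprB -mulrA ler_wpM2l//.
by have := prox_fun0_ge; rewrite mul1r.
Qed.

(** For eta > 0 this is [cond_eta]. For eta = 0 the division in [K] returns 0, and the term of [C]
    with [Lf] has to vanish on its own. *)
Lemma le_prox_constant : C * P0 <= (mu + eta) * ((1 + K) * P0).
Proof.
have alpha1 : 0 < 1 - alpha by rewrite subr_gt0.
have [eta0|eta_neq0] := eqVneq eta 0; last first.
  have eta_gt0 : 0 < eta by rewrite lt_neqAle eq_sym eta_neq0.
  rewrite mulrA ler_wpM2r ?prox_fun0_ge0//.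
  have -> : C = eta / alpha * (1 + K) by field; rewrite !gt_eqF.
  rewrite ler_wpM2r ?(potential_weight_ge 1)//.
  by rewrite addr_ge0// divr_ge0// mulr_ge0// ltW.
(* eta = 0 forces L_ i <= 0, so that either Lf = 0 or x0 = xs *)
have LfP0 : Lf * P0 = 0.
  have := Lf_le x0 xs.
  have L_le0 : \sum_(i < m) L_ i <= 0.
    by apply: sumr_le0 => i _; have := cond_L i; rewrite eta0 !mul0r; lra.
  have LN := mulr_le0_ge0 L_le0 (norm_ge0 N_norm (x0 - xs)).
  move=> /le_trans /(_ LN) LfN; have {LfN} : Lf * N (x0 - xs) = 0.
    by apply/eqP; rewrite eq_le LfN mulr_ge0// norm_ge0.
  move/eqP; rewrite mulf_eq0 => /orP[/eqP ->|/eqP N0]; first by rewrite mul0r.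
  have /eqP := norm_definite N_norm N0; rewrite subr_eq0 => /eqP ->.
  by rewrite /prox_fun subrr dotv0r addr0 subrr mulr0.
have -> : C * P0 = eta / alpha * P0 + (1 - alpha)^-1 * (Lf * P0) by ring.
rewrite LfP0 eta0 !(mul0r, mulr0, invr0, addr0) mul1r.
by rewrite mulr_ge0 ?prox_fun0_ge0// ltW.
Qed.

(** * Bounds in expectation *)

Section expectation.
Variable rep : seq 'I_m -> T.
Hypothesis repP : forall s, (size s <= k)%N -> history i_ (size s) (rep s) = s.

Local Notation "''E' t Z" := (hist_expect p t (fun s => Z (rep s)))
  (at level 10, t at level 8, Z at level 8).

(** The representatives of s and of its extension may be different outcomes, but they agree on the
    draws recorded in s. *)
Lemma history_rep_cons t s i : (t <= size s)%N -> (size s < k)%N ->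
  history i_ t (rep (i :: s)) = history i_ t (rep s).
Proof.
move=> ts sk; apply/history_eqP => r /andP[r1 rt].
have /= [_ e] := repP (s := i :: s) sk.
have /history_eqP := etrans e (esym (repP (ltnW sk))).
by apply; rewrite r1 (leq_trans rt).
Qed.

Lemma expect_rpdg_process_le t : (t <= k)%N -> 'E t (rpdg_process t) <= C * P0.
Proof.
move=> tk; apply: le_trans (rpdg_process0_le (rep [::])).
apply: (hist_expect_supermartingale p_ge0
  (Z := fun t s => rpdg_process t (rep s))) => s st.
have sk := leq_trans st tk.
apply: rpdg_process_step => // i; first exact: history_rep_cons.
by have /= [] := repP (s := i :: s) sk.
Qed.

Lemma expect_gap_prox_fun_le t : (1 <= t <= k)%N ->
  'E t (fun o => \sum_(1 <= r < t.+1) alpha ^- r * gap (x r o))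
  + alpha ^- t * (mu + eta) * 'E t (fun o => prox_fun w (x t o) (dw t o) xs)
  <= C * P0.
Proof.
move=> /andP[t1 tk]; apply: le_trans (expect_rpdg_process_le tk).
rewrite -hist_expectZ -hist_expectD; apply: hist_expect_le => // s _.
rewrite lerD2l -mulrA ler_wpM2l//; first by rewrite invr_ge0 exprn_ge0// ltW.
(* A positive time makes [potential_weight] equal to mu + eta. *)
case: t t1 tk => // t _ tk.
exact: (potential_ge w xs N_norm f_convex f_diff f_smooth p_ge0 p_sum1 tau_ge0
  eta_ge0 alpha_lt1 cond_p cond_L).
Qed.

Lemma gap_sum_ge0 t o : (t <= k)%N ->
  0 <= \sum_(1 <= r < t.+1) alpha ^- r * gap (x r o).
Proof.
move=> tk; rewrite big_nat; apply: sumr_ge0 => r /andP[_ rt].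
apply: mulr_ge0; first by rewrite invr_ge0 exprn_ge0// ltW.
apply: (linear_gap_ge0 X_convex N_norm f_convex f_diff Lf_smooth h_convex
  w_strongly_convex mu_gt0 xs_opt).
by apply: run_X; exact: leq_trans tk.
Qed.

Lemma expect_prox_fun_le t : (1 <= t <= k)%N ->
  'E t (fun o => prox_fun w (x t o) (dw t o) xs) <= (1 + K) * alpha ^+ t * P0.
Proof.
move=> t1k; have /andP[t1 tk] := t1k.
have mueta : 0 < mu + eta by rewrite ltr_pwDl.
have := le_trans (expect_gap_prox_fun_le t1k) le_prox_constant.
have S0 : 0 <= 'E t (fun o => \sum_(1 <= r < t.+1) alpha ^- r * gap (x r o)).
  by apply: (hist_expect_ge0 p_ge0) => s _; exact: gap_sum_ge0.
set E := hist_expect p t _ in S0 *; set F := hist_expect p t _ => h1.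
have {h1 S0} : (mu + eta) * (alpha ^- t * F) <= (mu + eta) * ((1 + K) * P0).
  by apply: le_trans h1; rewrite [leLHS]mulrCA [leLHS]mulrA lerDr.
rewrite ler_pM2l// ler_pdivrMl ?exprn_gt0// => /le_trans; apply.
by rewrite mulrCA mulrA.
Qed.

(** Iterate t ignores the later draws, so the average over k draws reduces to one over t draws,
    where strong convexity bounds the squared distance by twice the prox-function. *)
Lemma expect_norm_le t : (1 <= t <= k)%N ->
  'E k (fun o => N (x t o - xs) ^+ 2) <= 2 * ((1 + K) * alpha ^+ t * P0).
Proof.
move=> t1k; have /andP[t1 tk] := t1k.
have -> : 'E k (fun o => N (x t o - xs) ^+ 2)
    = 'E t (fun o => N (x t o - xs) ^+ 2).
  rewrite -(subnKC tk); apply: hist_expect_forget => // s i.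
  rewrite subnKC// => /andP[ts sk].
  by have [-> _ _ _] := run_nonanticipating tk (history_rep_cons i ts sk).
apply: le_trans (ler_wpM2l (ler0n _ 2) (expect_prox_fun_le t1k)).
rewrite -hist_expectZ; apply: hist_expect_le => // s st.
have := run_prox_fun_ge (rep s) tk.
rewrite -(norm_opp N_norm) opprB; lra.
Qed.

Lemma expect_objective_le : (1 <= k)%N ->
  'E k (fun o => Psi (ergodic_mean (fun t => alpha ^- t) (x ^~ o) k) - Psi xs)
  <= alpha `^ (k%:R / 2)
     * (alpha^-1 * eta + (3 - 2 * alpha) / (1 - alpha) * Lf
        + 2 * Lf ^+ 2 * alpha / ((1 - alpha) * eta)) * P0.
Proof.
move=> k1.
have alpha1 : 0 < 1 - alpha by rewrite subr_gt0.
have theta_gt0 t : 0 < alpha ^- t by rewrite invr_gt0 exprn_gt0.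
set A := alpha `^ (k%:R / 2).
pose Theta := \sum_(1 <= t < k.+1) alpha ^- t.
have Theta_gt0 : 0 < Theta by exact: geometric_sum_gt0.
have ThetaVk : Theta^-1 * k%:R <= A.
  by rewrite mulrC ler_pdivrMr//; exact: le_powR_geometric_sum.
have ThetaV : Theta^-1 <= A.
  apply: le_trans ThetaVk; rewrite ler_peMr ?ler1n//.
  by rewrite invr_ge0 ltW.
have K_ge0 : 0 <= K by rewrite divr_ge0// mulr_ge0// ltW.
have C_ge0 : 0 <= C by rewrite addr_ge0// divr_ge0// ltW.
(* The weight alpha^-t cancels the decay alpha^t of the expected squared distance, so the k
   smoothness errors have the same bound. *)
apply: (@le_trans _ _ (Theta^-1 * (C * P0 + Lf * ((1 + K) * P0) * k%:R))).
  apply: (@le_trans _ _ (hist_expect p k (fun s => Theta^-1 *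
      (\sum_(1 <= t < k.+1) alpha ^- t * gap (x t (rep s))
       + \sum_(1 <= t < k.+1) Lf / 2 * alpha ^- t * N (x t (rep s) - xs) ^+ 2)))).
    apply: hist_expect_le => // s _.
    have xX t : (1 <= t <= k)%N -> X (x t (rep s)) by case/andP => _; exact: run_X.
    apply: le_trans (ergodic_gap_le xs X_convex N_norm f_convex f_diff Lf_ge0
      Lf_smooth h_convex w_strongly_convex mu_gt0 theta_gt0 xX k1) _.
    rewrite le_eqVlt; apply/orP; left; apply/eqP; congr (_ * _).
    by rewrite -big_split; apply: eq_bigr => t _; rewrite /= mulrDr mulrCA !mulrA.
  rewrite hist_expectZ ler_wpM2l//; first by rewrite invr_ge0 ltW.
  rewrite hist_expectD lerD//.
    have := @expect_gap_prox_fun_le k; rewrite k1 leqnn => /(_ isT).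
    apply: le_trans; rewrite lerDl mulr_ge0//.
      by rewrite mulr_ge0 ?addr_ge0 ?(ltW mu_gt0) ?(ltW (theta_gt0 k)).
    by apply: (hist_expect_ge0 p_ge0) => s _; exact: run_prox_fun_ge0.
  rewrite hist_expect_sum.
  apply: (@le_trans _ _ (\sum_(1 <= t < k.+1) Lf * ((1 + K) * P0))); last first.
    by rewrite sumr_const_nat subn1 mulr_natr.
  rewrite !big_nat; apply: ler_sum => t /andP[t1 tk].
  rewrite hist_expectZ.
  have a0 : 0 <= Lf / 2 * alpha ^- t by rewrite mulr_ge0 ?divr_ge0 ?(ltW (theta_gt0 t)).
  have t1k : (1 <= t <= k)%N by rewrite t1.
  apply: le_trans (ler_wpM2l a0 (expect_norm_le t1k)) _.
  rewrite le_eqVlt; apply/orP; left; apply/eqP.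
  have : alpha ^+ t != 0 by rewrite expf_neq0// gt_eqF.
  move: (alpha ^+ t) => b b_neq0.
  by move: (1 + K) P0 => c P; field.
have hC : Theta^-1 * (C * P0) <= A * (C * P0).
  by rewrite ler_wpM2r// mulr_ge0// prox_fun0_ge0.
have hK : Theta^-1 * k%:R * (Lf * ((1 + K) * P0)) <= A * (Lf * ((1 + K) * P0)).
  rewrite ler_wpM2r// mulr_ge0// mulr_ge0 ?prox_fun0_ge0//.
  by rewrite addr_ge0.
have -> : Theta^-1 * (C * P0 + Lf * ((1 + K) * P0) * k%:R)
  = Theta^-1 * (C * P0) + Theta^-1 * k%:R * (Lf * ((1 + K) * P0)).
  by move: Theta^-1 => V; ring.
apply: le_trans (lerD hC hK) _.
have -> : A * (C * P0) + A * (Lf * ((1 + K) * P0)) = A * (C + Lf * (1 + K)) * P0.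
  by ring.
rewrite ler_wpM2r ?prox_fun0_ge0// ler_wpM2l ?powR_ge0//.
(* The target constant exceeds C + Lf (1 + K) by Lf + Lf K, which is nonnegative. *)
have -> : (3 - 2 * alpha) / (1 - alpha) * Lf = Lf / (1 - alpha) + 2 * Lf.
  by field; rewrite gt_eqF.
have -> : 2 * Lf ^+ 2 * alpha / ((1 - alpha) * eta) = 2 * (Lf * K).
  by rewrite expr2; ring.
have := mulr_ge0 Lf_ge0 K_ge0; move: Lf_ge0; lra.
Qed.

End expectation.

End rpdg_convergence.

(** * The two bounds under the probability measure *)

Theorem theorem2 (R : realType) (n m : nat)
  (X : set 'rV[R]_n) (N : 'rV[R]_n -> R)
  (f_ : 'I_m -> 'rV[R]_n -> R) (L_ : 'I_m -> R) (Lf : R)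
  (h w : 'rV[R]_n -> R) (mu : R) (xs : 'rV[R]_n)
  (p : 'I_m -> R) (tau eta alpha : R) (tau_ eta_ alpha_ : nat -> R)
  (k : nat) (x0 dw0 : 'rV[R]_n)
  (d : measure_display) (T : measurableType d) (Pr : probability T R)
  (i_ : nat -> T -> 'I_m) (x dw : nat -> T -> 'rV[R]_n)
  (xu y yt : nat -> T -> 'I_m -> 'rV[R]_n)
  (f := fun z => \sum_(i < m) f_ i z)
  (Psi := fun z => f z + h z + mu * w z)
  (theta := fun t : nat => alpha ^- t)
  (* problem data *)
  (X_closed : closed X)
  (X_convex : convex_set X)
  (N_norm : is_norm N)
  (f_convex : forall i, convex_function setT (f_ i))
  (f_diff : forall i z, differentiable (f_ i : 'rV[R]_n -> R^o) z)
  (f_smooth : forall i z1 z2,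
     conjugate_norm N (grad (f_ i) z1 - grad (f_ i) z2)
       <= L_ i * N (z1 - z2))
  (Lf_ge0 : 0 <= Lf)
  (Lf_smooth : forall z1 z2,
     conjugate_norm N (grad f z1 - grad f z2) <= Lf * N (z1 - z2))
  (Lf_le : forall z1 z2,
     Lf * N (z1 - z2) <= (\sum_(i < m) L_ i) * N (z1 - z2))
  (h_convex : convex_function X h)
  (w_strongly_convex : strongly_convex N X 1 w)
  (mu_gt0 : 0 < mu)
  (xs_opt : is_minimizer X Psi xs)
  (* parameters *)
  (p_ge0 : forall i, 0 <= p i)
  (p_sum1 : \sum_(i < m) p i = 1)
  (tau_cst : forall t, (1 <= t)%N -> tau_ t = tau)
  (eta_cst : forall t, (1 <= t)%N -> eta_ t = eta)
  (alpha_cst : forall t, (1 <= t)%N -> alpha_ t = alpha)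
  (tau_ge0 : 0 <= tau)
  (eta_ge0 : 0 <= eta)
  (alpha_gt0 : 0 < alpha)
  (alpha_lt1 : alpha < 1)
  (cond_p : forall i, (1 - alpha) * (1 + tau) <= p i)
  (cond_eta : eta <= alpha * (mu + eta))
  (cond_L : forall i, 4 * L_ i <= eta * tau * p i)
  (* k iterations of the method *)
  (k_ge1 : (1 <= k)%N)
  (x0_X : X x0)
  (dw0_sub : is_subgradient X w x0 dw0)
  (draws : independent_draws Pr p k i_)
  (dw_nonanticipating : nonanticipating k i_ dw)
  (run : forall o : T,
     rpdg_run X f_ h w mu p tau_ eta_ alpha_ k x0 dw0 (i_ ^~ o)
       (x ^~ o) (dw ^~ o) (xu ^~ o) (y ^~ o) (yt ^~ o)) :
  ('E_Pr[fun o => prox_fun w (x k o) (dw k o) xs]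
     <= ((1 + Lf * alpha / ((1 - alpha) * eta)) * alpha ^+ k
         * prox_fun w x0 dw0 xs)%:E)%E /\
  ('E_Pr[fun o => (Psi (ergodic_mean theta (x ^~ o) k) - Psi xs)%R]
     <= (alpha `^ (k%:R / 2)
         * (alpha^-1 * eta + (3 - 2 * alpha) / (1 - alpha) * Lf
            + 2 * Lf ^+ 2 * alpha / ((1 - alpha) * eta))
         * prox_fun w x0 dw0 xs)%:E)%E.
Proof.
have p_gt0 := prob_gt0 tau_ge0 alpha_lt1 cond_p.
have [rep repP] := history_representative draws p_gt0.
(* A variable determined by the history equals its value at the representative of that history, so
   its integral becomes a finite sum. *)
have expectE Z : (forall o1 o2, history i_ k o1 = history i_ k o2 -> Z o1 = Z o2) ->
    ('E_Pr[Z] = (hist_expect p k (fun s => Z (rep s)))%:E)%E.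
  move=> Zhist; rewrite -(expectation_history draws _ (leqnn k)).
  congr expectation; apply/funext => o; apply: Zhist.
  have := repP (history i_ k o); rewrite size_history => ->//.
have hist_r r o1 o2 : (r <= k)%N -> history i_ k o1 = history i_ k o2 ->
    history i_ r o1 = history i_ r o2.
  move=> rk /history_eqP e; apply/history_eqP => q /andP[q1 qr].
  by apply: e; rewrite q1 (leq_trans qr).
have nonant r o1 o2 : (r <= k)%N -> history i_ k o1 = history i_ k o2 ->
    x r o1 = x r o2 /\ dw r o1 = dw r o2.
  move=> rk /(hist_r _ _ _ rk) e.
  have [] // := run_nonanticipating X_convex N_norm h_convex w_strongly_convex
    mu_gt0 tau_cst eta_cst alpha_cst eta_ge0 dw_nonanticipating run rk e.
split.
  rewrite expectE => [|o1 o2 /(nonant _ _ _ (leqnn k))[-> ->]//].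
  rewrite lee_fin; apply: (expect_prox_fun_le X_convex N_norm f_convex f_diff
    f_smooth Lf_ge0 Lf_smooth Lf_le h_convex w_strongly_convex mu_gt0 xs_opt
    p_ge0 p_sum1 tau_cst eta_cst alpha_cst tau_ge0 eta_ge0 alpha_gt0 alpha_lt1
    cond_p cond_eta cond_L x0_X dw0_sub dw_nonanticipating run repP).
  by rewrite k_ge1 leqnn.
rewrite expectE => [|o1 o2 e]; last first.
  congr (Psi _ - _); rewrite /ergodic_mean; congr (_ *: _).
  apply: eq_big_nat => t /andP[_ tk].
  by have [-> _] := nonant _ _ _ tk e.
rewrite lee_fin; exact: (expect_objective_le X_convex N_norm f_convex f_diff
  f_smooth Lf_ge0 Lf_smooth Lf_le h_convex w_strongly_convex mu_gt0 xs_opt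
  p_ge0 p_sum1 tau_cst eta_cst alpha_cst tau_ge0 eta_ge0 alpha_gt0 alpha_lt1
  cond_p cond_eta cond_L x0_X dw0_sub dw_nonanticipating run repP k_ge1).
Qed.
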